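(* Let $(A,\mathfrak m)$ be a Noetherian local ring with maximal ideal $\mathfrak m$ and infinite residue field $A/\mathfrak m$, and let $\mathcal F=\{I_n\}_{n\ge0}$ be a good filtration of ideals in $A$ with $\ell(\mathcal F)=1$. For a positive integer $T$ set $\mathcal F^{(T)}=\{I_{Tn}\}_{n\ge0}$. Then $F_{\mathfrak m}(\mathcal F^{(T)})=\bigoplus_{n\ge0}(I_{Tn}/\mathfrak m I_{Tn})t^n$ is Cohen–Macaulay for all large $T$ (i.e. there is $T_0$ such that this holds for all $T\ge T_0$).
   Context: A filtration $\mathcal F=\{I_n\}_{n\ge0}$ of ideals in $A$ is a chain of ideals with $I_0=A$, $I_1$ a proper ideal, $I_{n+1}\subseteq I_n$ and $I_nI_m\subseteq I_{n+m}$ for all $n,m\ge0$. For an ideal $I$ of $A$, $\mathcal F$ is an $I$-good filtration if $II_n\subseteq I_{n+1}$ for all $n\ge0$ and $I_{n+1}=II_n$ for all large $n$. $\mathcal F$ is good if it is $I$-good for some ideal $I$ of $A$. The fiber cone of $\mathcal F$ with respect to $\mathfrak m$ is the graded ring $F_{\mathfrak m}(\mathcal F)=\bigoplus_{n\ge0}(I_n/\mathfrak mI_n)t^n$, and the analytic spread of $\mathcal F$ is $\ell(\mathcal F)=\dim F_{\mathfrak m}(\mathcal F)$. *)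

(* Defs.v *)
From HB Require Import structures.
From mathcomp Require Import all_boot all_order all_algebra.
From mathcomp Require Import boolp classical_sets cardinality.
From mathcomp Require Import ring.

Set Implicit Arguments.
Unset Strict Implicit.
Unset Printing Implicit Defensive.

Import GRing.Theory.
Local Open Scope ring_scope.
Local Open Scope quotient_scope.

(* [idealr R] and [prime_idealr R] (ring_quotient) are the proper, resp. prime,
   ideals of [R]; [ideal_closed] also allows the unit ideal.  Membership is
   boolean as the library requires, but classical, through [`[< _ >]]. *)

Section Ideals.
Variable R : comNzRingType.
Implicit Types I J : {pred R}.

Definition ideal_closed I : Prop :=
  0 \in I /\ forall a, {in I &, forall u v, a * u + v \in I}.

Definition ideal_mul I J : {pred R} :=
  [pred x | `[< exists s : seq (R * R),
      (forall c, c \in s -> c.1 \in I /\ c.2 \in J) /\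
      x = \sum_(c <- s) c.1 * c.2 >]].

Definition ideal_gen (s : seq R) : {pred R} :=
  [pred x | `[< exists a : nat -> R, x = \sum_(i < size s) a i * s`_i >]].

Definition noetherian : Prop :=
  forall I, ideal_closed I -> exists s : seq R, I =i ideal_gen s.

Definition maximal_ideal (m : idealr R) : Prop :=
  forall J : idealr R, {subset m <= J} -> {subset J <= m}.

Definition local_with (m : idealr R) : Prop :=
  maximal_ideal m /\ forall n : idealr R, maximal_ideal n -> n =i m.

(* p 0 < p 1 < ... < p n *)
Definition prime_chain (n : nat) (p : nat -> prime_idealr R) : Prop :=
  forall i, (i < n)%N ->
    {subset p i <= p i.+1} /\ ~ {subset p i.+1 <= p i}.

Definition krull_dim_eq (d : nat) : Prop :=
  (exists p, prime_chain d p) /\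
  (forall n p, prime_chain n p -> (n <= d)%N).

(* Multiplication by x_i is injective on R/(x_0, ..., x_(i-1)) and
   R/(x_0, ..., x_(n-1)) is nonzero. *)
Definition regular_seq (x : seq R) : Prop :=
  (forall i, (i < size x)%N -> forall y : R,
     y * x`_i \in ideal_gen (take i x) -> y \in ideal_gen (take i x)) /\
  1 \notin ideal_gen x.

Definition depth_eq (m : idealr R) (d : nat) : Prop :=
  (exists x, [/\ regular_seq x, {subset x <= m} & size x = d]) /\
  (forall x, regular_seq x -> {subset x <= m} -> (size x <= d)%N).

Definition cohen_macaulay_local : Prop :=
  exists m : idealr R, [/\ local_with m, noetherian &
    exists2 d, krull_dim_eq d & depth_eq m d].

End Ideals.

Arguments noetherian R : clear implicits.
Arguments krull_dim_eq R d : clear implicits.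
Arguments cohen_macaulay_local R : clear implicits.

Section Localization.
Variables (R : comNzRingType) (p : prime_idealr R).

Record denom := Denom { dval : R; _ : dval \notin p }.
HB.instance Definition _ := [isSub for dval].
HB.instance Definition _ := [Choice of denom by <:].

Lemma denomP (s : denom) : dval s \notin p.
Proof. by case: s. Qed.

Lemma denom1_subproof : 1 \notin p.
Proof. by rewrite idealr1. Qed.
Definition denom1 := Denom denom1_subproof.

Lemma denomM_subproof (s t : denom) : dval s * dval t \notin p.
Proof. by rewrite prime_idealrM negb_or !denomP. Qed.
Definition denomM s t := Denom (denomM_subproof s t).

Definition loc_equiv (x y : R * denom) : bool :=
  `[< exists u : denom,
        dval u * (x.1 * dval y.2) = dval u * (y.1 * dval x.2) >].

Lemma loc_equiv_is_equiv : equiv_class_of loc_equiv.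
Proof.
split=> [x|x y|y x z].
- by apply/asboolP; exists denom1.
- by apply/asboolP/asboolP => -[u eu]; exists u.
move=> /asboolP[u eu] /asboolP[v ev]; apply/asboolP.
exists (denomM (denomM u v) y.2) => /=.
transitivity (dval v * dval z.2 * (dval u * (x.1 * dval y.2))); first by ring.
rewrite eu.
transitivity (dval u * dval x.2 * (dval v * (y.1 * dval z.2))); first by ring.
by rewrite ev; ring.
Qed.

Canonical loc_equiv_equiv := EquivRelPack loc_equiv_is_equiv.
Canonical loc_equiv_encModRel := defaultEncModRel loc_equiv.

Definition loc := {eq_quot loc_equiv}.
HB.instance Definition _ : EqQuotient _ loc_equiv loc := EqQuotient.on loc.
HB.instance Definition _ := Choice.on loc.

Definition frac (a : R) (s : denom) : loc := \pi_loc (a, s).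

Lemma frac_eqP a s b t : frac a s = frac b t <->
  exists u : denom, dval u * (a * dval t) = dval u * (b * dval s).
Proof.
rewrite /frac; split=> [/eqmodP/asboolP//|h].
by apply/eqmodP/asboolP.
Qed.

Lemma frac_surj (x : loc) : exists a s, x = frac a s.
Proof. by exists (repr x).1, (repr x).2; rewrite /frac -surjective_pairing reprK. Qed.

Definition loc_num (x : loc) : R := (repr x).1.
Definition loc_den (x : loc) : denom := (repr x).2.

Lemma loc_numdenK x : frac (loc_num x) (loc_den x) = x.
Proof. by rewrite /frac -surjective_pairing reprK. Qed.

Definition loc_zero : loc := frac 0 denom1.
Definition loc_one : loc := frac 1 denom1.
Definition loc_opp (x : loc) : loc := frac (- loc_num x) (loc_den x).
Definition loc_add (x y : loc) : loc :=
  frac (loc_num x * dval (loc_den y) + loc_num y * dval (loc_den x))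
       (denomM (loc_den x) (loc_den y)).
Definition loc_mul (x y : loc) : loc :=
  frac (loc_num x * loc_num y) (denomM (loc_den x) (loc_den y)).

Lemma loc_oppE a s : loc_opp (frac a s) = frac (- a) s.
Proof.
have /frac_eqP[u eu] := loc_numdenK (frac a s).
by apply/frac_eqP; exists u; rewrite !mulNr !mulrN eu.
Qed.

Lemma loc_addE a s b t : loc_add (frac a s) (frac b t) =
  frac (a * dval t + b * dval s) (denomM s t).
Proof.
have /frac_eqP[u eu] := loc_numdenK (frac a s).
have /frac_eqP[v ev] := loc_numdenK (frac b t).
rewrite /loc_add; set a' := loc_num _ in eu *; set s' := loc_den _ in eu *.
set b' := loc_num _ in ev *; set t' := loc_den _ in ev *.
apply/frac_eqP; exists (denomM u v) => /=.
transitivity (dval v * dval t' * dval t * (dval u * (a' * dval s)) +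
              dval u * dval s' * dval s * (dval v * (b' * dval t))); first by ring.
by rewrite eu ev; ring.
Qed.

Lemma loc_mulE a s b t : loc_mul (frac a s) (frac b t) =
  frac (a * b) (denomM s t).
Proof.
have /frac_eqP[u eu] := loc_numdenK (frac a s).
have /frac_eqP[v ev] := loc_numdenK (frac b t).
rewrite /loc_mul; set a' := loc_num _ in eu *; set s' := loc_den _ in eu *.
set b' := loc_num _ in ev *; set t' := loc_den _ in ev *.
apply/frac_eqP; exists (denomM u v) => /=.
transitivity ((dval u * (a' * dval s)) * (dval v * (b' * dval t))); first by ring.
by rewrite eu ev; ring.
Qed.

Lemma loc_addA : associative loc_add.
Proof.
move=> x y z; have [a [s ->]] := frac_surj x.
have [b [t ->]] := frac_surj y; have [c [r ->]] := frac_surj z.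
rewrite !loc_addE; apply/frac_eqP; exists denom1 => /=; ring.
Qed.

Lemma loc_addC : commutative loc_add.
Proof.
move=> x y; have [a [s ->]] := frac_surj x; have [b [t ->]] := frac_surj y.
rewrite !loc_addE; apply/frac_eqP; exists denom1 => /=; ring.
Qed.

Lemma loc_add0 : left_id loc_zero loc_add.
Proof.
move=> x; have [a [s ->]] := frac_surj x.
rewrite !loc_addE; apply/frac_eqP; exists denom1 => /=; ring.
Qed.

Lemma loc_addN : left_inverse loc_zero loc_opp loc_add.
Proof.
move=> x; have [a [s ->]] := frac_surj x.
rewrite loc_oppE loc_addE; apply/frac_eqP; exists denom1 => /=; ring.
Qed.

Lemma loc_mulA : associative loc_mul.
Proof.
move=> x y z; have [a [s ->]] := frac_surj x.
have [b [t ->]] := frac_surj y; have [c [r ->]] := frac_surj z.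
rewrite !loc_mulE; apply/frac_eqP; exists denom1 => /=; ring.
Qed.

Lemma loc_mulC : commutative loc_mul.
Proof.
move=> x y; have [a [s ->]] := frac_surj x; have [b [t ->]] := frac_surj y.
rewrite !loc_mulE; apply/frac_eqP; exists denom1 => /=; ring.
Qed.

Lemma loc_mul1 : left_id loc_one loc_mul.
Proof.
move=> x; have [a [s ->]] := frac_surj x.
rewrite !loc_mulE; apply/frac_eqP; exists denom1 => /=; ring.
Qed.

Lemma loc_mulDl : left_distributive loc_mul loc_add.
Proof.
move=> x y z; have [a [s ->]] := frac_surj x.
have [b [t ->]] := frac_surj y; have [c [r ->]] := frac_surj z.
rewrite !(loc_mulE, loc_addE); apply/frac_eqP; exists denom1 => /=; ring.
Qed.

Lemma loc_1neq0 : loc_one != loc_zero.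
Proof.
apply/eqP => /frac_eqP[u]; rewrite /= !mulr1 mulr0 => u0.
by have := denomP u; rewrite u0 rpred0.
Qed.

HB.instance Definition _ :=
  GRing.isZmodule.Build loc loc_addA loc_addC loc_add0 loc_addN.
HB.instance Definition _ := GRing.Zmodule_isComNzRing.Build loc
  loc_mulA loc_mulC loc_mul1 loc_mulDl loc_1neq0.

End Localization.

Definition cohen_macaulay (R : comNzRingType) : Prop :=
  noetherian R /\
  forall p : prime_idealr R, maximal_ideal p -> cohen_macaulay_local (loc p).

Record filtration (A : comNzRingType) := Filtration {
  fil :> nat -> {pred A};
  fil_ideal : forall n, ideal_closed (fil n);
  fil_0 : forall x, x \in fil 0%N;
  fil_1 : 1 \notin fil 1%N;
  fil_S : forall n, {subset fil n.+1 <= fil n};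
  fil_M : forall n k, {subset ideal_mul (fil n) (fil k) <= fil (n + k)%N}
}.

Section Filtrations.
Variable A : comNzRingType.
Implicit Type F : filtration A.

Definition good_for (I : {pred A}) F : Prop :=
  [/\ ideal_closed I,
      forall n, {subset ideal_mul I (F n) <= F n.+1} &
      exists n0, forall n, (n0 <= n)%N -> F n.+1 =i ideal_mul I (F n)].

Definition good_filtration F : Prop := exists I, good_for I F.

Lemma fil_le F i j : (i <= j)%N -> {subset F j <= F i}.
Proof.
move=> /subnK<-; elim: (j - i)%N => // k IHk x.
by rewrite addSn => /fil_S/IHk.
Qed.

Section Veronese.
Variables (F : filtration A) (T : nat) (T_gt0 : (0 < T)%N).

Let V n : {pred A} := F (T * n)%N.

Fact veronese_0 x : x \in V 0%N.
Proof. by rewrite /V muln0 fil_0. Qed.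

Fact veronese_1 : 1 \notin V 1%N.
Proof. by rewrite /V muln1; apply: contra (fil_1 F); apply: fil_le. Qed.

Fact veronese_S n : {subset V n.+1 <= V n}.
Proof. by apply: fil_le; rewrite leq_mul2l leqnSn orbT. Qed.

Fact veronese_M n k : {subset ideal_mul (V n) (V k) <= V (n + k)%N}.
Proof. by move=> x; rewrite /V mulnDr; apply: fil_M. Qed.

Definition veronese : filtration A :=
  @Filtration A (fun n => F (T * n)%N) (fun n => fil_ideal F (T * n))
    veronese_0 veronese_1 veronese_S veronese_M.

End Veronese.

End Filtrations.

Section IdealLemmas.
Variables (R : comNzRingType) (I : {pred R}).
Hypothesis I_ideal : ideal_closed I.

Lemma ideal_closedD : {in I &, forall x y, x + y \in I}.
Proof. by move=> x y xI yI; rewrite -[x]mul1r I_ideal.2. Qed.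

Lemma ideal_closedMr a : {in I, forall x, a * x \in I}.
Proof. by move=> x xI; rewrite -[_ * _]addr0 I_ideal.2 ?I_ideal.1. Qed.

Lemma ideal_closed_sum (K : eqType) (r : seq K) (f : K -> R) :
  (forall i, i \in r -> f i \in I) -> \sum_(i <- r) f i \in I.
Proof.
move=> fI; rewrite big_seq; elim/big_ind: _ => //; first exact: I_ideal.1.
exact: ideal_closedD.
Qed.

End IdealLemmas.

Lemma ideal_mul_closed (R : comNzRingType) (I J : {pred R}) :
  ideal_closed I -> ideal_closed (ideal_mul I J).
Proof.
move=> I_ideal; split.
  by apply/asboolP; exists [::]; split=> //; rewrite big_nil.
move=> a x y /asboolP[s [sIJ ->]] /asboolP[r [rIJ ->]]; apply/asboolP.
exists ([seq (a * c.1, c.2) | c <- s] ++ r); split.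
  move=> c; rewrite mem_cat => /orP[/mapP[d /sIJ[dI dJ] ->]|/rIJ//].
  by split=> //=; apply: ideal_closedMr.
rewrite big_cat big_map mulr_sumr; congr (_ + _).
by apply: eq_bigr => c _; rewrite mulrA.
Qed.

Lemma ideal_mulP (R : comNzRingType) (I J : {pred R}) x y :
  x \in I -> y \in J -> x * y \in ideal_mul I J.
Proof.
move=> xI yJ; apply/asboolP; exists [:: (x, y)]; rewrite big_seq1.
by split=> // c; rewrite inE => /eqP->.
Qed.

Lemma ideal_mul_sub (R : comNzRingType) (I J K : {pred R}) : ideal_closed K ->
  (forall x y, x \in I -> y \in J -> x * y \in K) -> {subset ideal_mul I J <= K}.
Proof.
move=> K_ideal IJK x /asboolP[s [sIJ ->]]; apply: ideal_closed_sum => // c.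
by move=> /sIJ[]; apply: IJK.
Qed.

Lemma idealr_ideal_closed (R : comNzRingType) (m : idealr R) : ideal_closed m.
Proof. by split=> [|a x y xm ym]; rewrite ?rpred0 // rpredD // idealMr. Qed.

(* The Rees algebra of F: polynomials whose coefficient of X^n lies in F n. *)
Section Rees.
Variables (A : comNzRingType) (F : filtration A).

Definition rees_pred : {pred {poly A}} :=
  fun f => `[< forall n, f`_n \in F n >].

Lemma reesP (f : {poly A}) : reflect (forall n, f`_n \in F n) (f \in rees_pred).
Proof. exact: asboolP. Qed.

Fact rees_subring : subring_closed rees_pred.
Proof.
split=> [|f g /reesP fF /reesP gF|f g /reesP fF /reesP gF]; apply/reesP => n.
- by rewrite coef1; case: n => [|n]; rewrite ?fil_0 ?(fil_ideal F _).1.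
- rewrite coefB -mulN1r addrC; exact: (fil_ideal F n).2.
rewrite coefM; apply: (ideal_closed_sum (fil_ideal F n)) => i _.
rewrite -[X in F X](subnKC (leq_ord i)).
by apply: fil_M; apply: ideal_mulP.
Qed.
HB.instance Definition _ := GRing.isSubringClosed.Build {poly A} rees_pred
  rees_subring.

Record rees := Rees { rees_val : {poly A}; _ : rees_val \in rees_pred }.
HB.instance Definition _ := [isSub for rees_val].
HB.instance Definition _ := [Choice of rees by <:].
HB.instance Definition _ := [SubChoice_isSubComNzRing of rees by <:].

End Rees.

(* The fiber cone, the direct sum of the F n / m F n with the multiplication
   induced by A, as the quotient of the Rees algebra (the direct sum of the
   F n) by the direct sum of the m F n. *)
Section FiberCone.
Variables (A : comNzRingType) (m : idealr A) (F : filtration A).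

Definition mrees : {pred rees F} :=
  fun f => `[< forall n, (rees_val f)`_n \in ideal_mul m (F n) >].

Fact mrees_idealr : idealr_closed mrees.
Proof.
have mF n := ideal_mul_closed (F n) (idealr_ideal_closed m).
split; first by apply/asboolP => n; rewrite coef0; case: (mF n).
  apply/asboolP => /(_ 0%N); rewrite coef1 /= => m1.
  suff: 1 \in m by rewrite idealr1.
  apply: (ideal_mul_sub (idealr_ideal_closed m)) m1 => x y xm _.
  by rewrite mulrC idealMr.
move=> a f g /asboolP fm /asboolP gm; apply/asboolP => n.
rewrite coefD coefM; apply: (ideal_closedD (mF n)) => //.
apply: (ideal_closed_sum (mF n)) => i _.
have /asboolP[s [smF ->]] := fm (n - i)%N; rewrite mulr_sumr.
apply: (ideal_closed_sum (mF n)) => c /smF[cm cF].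
rewrite mulrCA; apply: ideal_mulP => //.
rewrite -[X in F X](subnKC (leq_ord i)); apply: fil_M; apply: ideal_mulP => //.
by case: a => ? /= /reesP.
Qed.
HB.instance Definition _ := isIdealr.Build (rees F) mrees mrees_idealr.

Definition fiber_cone : comNzRingType := {ideal_quot mrees}.

Definition analytic_spread_eq (d : nat) : Prop := krull_dim_eq fiber_cone d.

End FiberCone.

(* Main.v *)
(* Let [F] be [I]-good and [R = fiber_cone m F].  Since the residue field is
   infinite, some [x] in [I] avoids, in degree 1, all minimal primes of [R] that
   do not contain the whole of [I t]; as [dim R = 1], the only prime between
   [x t] and the irrelevant ideal is the latter, whence
   [F n.+1 = x F n + m F n.+1] for large [n].  Multiplication by [x t] on [R] is
   then onto in large degrees, injective there because the annihilators of the
   powers of [x t] are stationary, and no power [x ^ T] lies in [m F T] because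
   otherwise [R] would have dimension 0.

   For [V n = F (T n)] with [T] large, [y = x ^ T t] is therefore a nonzerodivisor
   of [G = fiber_cone m V] and [y G_n = G_(n+1)] for [n > 0].  So [G] is integral
   over the polynomial ring in [y] over the residue field, and has no chain of
   three primes.  Elements of [G] outside the irrelevant ideal are
   nonzerodivisors and [y] is one inside it, so every maximal ideal contains a
   nonzerodivisor, and the localization there has depth and dimension 1. *)

Require Import Defs.
From mathcomp Require Import all_boot all_order all_algebra.
From mathcomp Require Import boolp classical_sets cardinality.
From HB Require Import structures.
From mathcomp Require Import ring.

Set Implicit Arguments.
Unset Strict Implicit.
Unset Printing Implicit Defensive.

Import GRing.Theory.
Local Open Scope ring_scope.
Local Open Scope quotient_scope.

(** * Ideals and primes of noetherian rings *)

Section IdealGeneration.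
Variable R : comNzRingType.
Implicit Types I J : {pred R}.

Lemma idealr_of I : ideal_closed I -> 1 \notin I -> exists J : idealr R, J =i I.
Proof.
move=> [I0 ID] I1.
have Ic : idealr_closed I by split.
pose J : idealr R := HB.pack (I : R -> bool) (isIdealr.Build R I Ic).
by exists J.
Qed.

Lemma prime_idealr_of I : ideal_closed I -> 1 \notin I ->
  (forall u v, u * v \in I -> u \in I \/ v \in I) ->
  exists P : prime_idealr R, P =i I.
Proof.
move=> [I0 IDM] I1 IM.
have Ic : idealr_closed I by split.
have Ip : prime_idealr_closed I by move=> u v /IM[] ->; rewrite ?orbT.
pose P : prime_idealr R := HB.pack (I : R -> bool) (isIdealr.Build R I Ic)
  (isPrimeIdealrClosed.Build R I Ip).
by exists P.
Qed.

Lemma ideal_gen_closed (s : seq R) : ideal_closed (ideal_gen s).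
Proof.
split=> [|a u v /asboolP[b ->] /asboolP[c ->]]; apply/asboolP.
  by exists (fun=> 0); rewrite big1 // => i _; rewrite mul0r.
exists (fun i => a * b i + c i); rewrite mulr_sumr -big_split /=.
by apply: eq_bigr => i _; rewrite mulrDl mulrA.
Qed.

Lemma mem_ideal_gen (s : seq R) x : x \in s -> x \in ideal_gen s.
Proof.
move=> xs; apply/asboolP; exists (fun i => (i == index x s)%:R).
rewrite -index_mem in xs; rewrite (bigD1 (Ordinal xs)) //= eqxx mul1r.
rewrite nth_index -?index_mem // big1 ?addr0 // => i.
by rewrite -val_eqE /= => /negPf->; rewrite mul0r.
Qed.

Lemma ideal_gen_sub (s : seq R) I : ideal_closed I ->
  {subset s <= I} -> {subset ideal_gen s <= I}.
Proof.
move=> Ii sI x /asboolP[a ->]; apply: ideal_closed_sum => // i _.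
by apply: ideal_closedMr => //; apply/sI/mem_nth.
Qed.

Lemma ideal_gen_catl (s t : seq R) :
  {subset ideal_gen s <= ideal_gen (s ++ t)}.
Proof.
apply: ideal_gen_sub; first exact: ideal_gen_closed.
by move=> x xs; apply: mem_ideal_gen; rewrite mem_cat xs.
Qed.

Lemma ideal_gen_catr (s t : seq R) :
  {subset ideal_gen t <= ideal_gen (s ++ t)}.
Proof.
apply: ideal_gen_sub; first exact: ideal_gen_closed.
by move=> x xs; apply: mem_ideal_gen; rewrite mem_cat xs orbT.
Qed.

Lemma ideal_closedN I x : ideal_closed I -> x \in I -> - x \in I.
Proof. by move=> Ii xI; rewrite -mulN1r ideal_closedMr. Qed.

Lemma ideal_closedB I x y : ideal_closed I -> x \in I -> y \in I -> x - y \in I.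
Proof. by move=> Ii xI yI; apply: ideal_closedD => //; apply: ideal_closedN. Qed.

Definition ideal_adjoin I (a : R) : {pred R} :=
  [pred x | `[< exists u b, u \in I /\ x = u + b * a >]].

Lemma ideal_adjoin_closed I a : ideal_closed I -> ideal_closed (ideal_adjoin I a).
Proof.
move=> Ii; split.
  by apply/asboolP; exists 0, 0; split; [exact: Ii.1 | ring].
move=> c _ _ /asboolP[u [b [uI ->]]] /asboolP[v [d [vI ->]]]; apply/asboolP.
by exists (c * u + v), (c * b + d); split; [exact: Ii.2 | ring].
Qed.

Lemma sub_ideal_adjoin I a : {subset I <= ideal_adjoin I a}.
Proof. by move=> x xI; apply/asboolP; exists x, 0; split=> //; ring. Qed.

Lemma mem_ideal_adjoin I a : ideal_closed I -> a \in ideal_adjoin I a.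
Proof. by move=> Ii; apply/asboolP; exists 0, 1; split; [exact: Ii.1 | ring]. Qed.

Lemma ideal_adjoin_mul I a b x y : ideal_closed I -> a * b \in I ->
  x \in ideal_adjoin I a -> y \in ideal_adjoin I b -> x * y \in I.
Proof.
move=> Ii abI /asboolP[u [c [uI ->]]] /asboolP[v [d [vI ->]]].
have -> : (u + c * a) * (v + d * b) =
  (v + d * b) * u + (c * a * v + c * d * (a * b)) by ring.
by apply: Ii.2 => //; apply: Ii.2 => //; apply: ideal_closedMr.
Qed.

End IdealGeneration.

Section NoetherianRings.
Variable R : comNzRingType.
Hypothesis R_noetherian : noetherian R.
Implicit Types I J : {pred R}.

(** The union of the chain is an ideal, and its finitely many generators all lie in one member,
    which then contains every other. *)
Lemma noetherian_chain (I : nat -> {pred R}) :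
  (forall n, ideal_closed (I n)) -> (forall n, {subset I n <= I n.+1}) ->
  exists n, forall k, {subset I k <= I n}.
Proof.
move=> Ii IS; have Ile i j : (i <= j)%N -> {subset I i <= I j}.
  by move=> /subnK<-; elim: (j - i)%N => // k IHk x /IHk/IS.
pose U : {pred R} := [pred x | `[< exists n, x \in I n >]].
have Ui : ideal_closed U.
  split=> [|a u v /asboolP[n uI] /asboolP[k vI]]; apply/asboolP.
    by exists 0%N; apply: (Ii 0%N).1.
  exists (maxn n k); apply: (Ii _).2.
    by apply: Ile uI; apply: leq_maxl.
  by apply: Ile vI; apply: leq_maxr.
have [s Us] := R_noetherian Ui.
have [n sI] : exists n, {subset s <= I n}.
  have: {subset s <= U} by move=> x xs; rewrite Us mem_ideal_gen.
  elim: s {Us} => [_|x s IHs sU]; first by exists 0%N.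
  have [|n sI] := IHs; first by move=> y ys; apply: sU; rewrite inE ys orbT.
  have /asboolP[k xI] := sU x (mem_head _ _).
  exists (maxn n k) => y; rewrite inE => /predU1P[->|/sI yI].
    by apply: Ile xI; apply: leq_maxr.
  by apply: Ile yI; apply: leq_maxl.
exists n => k x xI; apply: (ideal_gen_sub (Ii n) sI).
by rewrite -Us; apply/asboolP; exists k.
Qed.

(** Without a maximal member, choice would iterate strict enlargements into a chain of ideals that
    never stabilizes. *)
Lemma noetherian_max (P : {pred R} -> Prop) I0 : ideal_closed I0 -> P I0 ->
  exists I, [/\ ideal_closed I, P I &
    forall J, ideal_closed J -> P J -> {subset I <= J} -> {subset J <= I}].
Proof.
move=> I0i PI0; apply: contrapT => nomax.
pose T := {I : {pred R} | ideal_closed I /\ P I}.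
have /choice[f fP] (I : T) : exists J : T,
    {subset sval I <= sval J} /\ ~ {subset sval J <= sval I}.
  case: I => I [Ii PI] /=; apply: contrapT => noJ; apply: nomax.
  exists I; split=> // J Ji PJ IJ; apply: contrapT => JI; apply: noJ.
  by exists (exist _ J (conj Ji PJ)).
pose c n := iter n f (exist _ I0 (conj I0i PI0)).
have [n cn] := @noetherian_chain (fun n => sval (c n))
  (fun n => (svalP (c n)).1) (fun n => (fP (c n)).1).
by have [_] := fP (c n); apply; apply: (cn n.+1).
Qed.

(** An ideal [K] maximal among those over [I] that miss [S] is prime: if [a] and [b] are outside
    [K], the ideals [K + (a)] and [K + (b)] both meet [S], and for [a * b] in [K] the product of the
    two meeting points would lie in [K]. *)
Lemma prime_avoiding I (S : R -> Prop) : ideal_closed I -> S 1 ->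
  (forall x y, S x -> S y -> S (x * y)) -> (forall x, x \in I -> ~ S x) ->
  exists P : prime_idealr R, {subset I <= P} /\ forall x, x \in P -> ~ S x.
Proof.
move=> Ii S1 SM IS.
have [|K [Ki [IK KS] Kmax]] := @noetherian_max
  (fun K => {subset I <= K} /\ forall x, x \in K -> ~ S x) I Ii; first by split.
have adjS a : a \notin K -> exists2 x, x \in ideal_adjoin K a & S x.
  move=> aK; apply: contrapT => noS; case/negP: aK.
  apply: (Kmax (ideal_adjoin K a)); first exact: ideal_adjoin_closed.
  - split=> [x /IK/sub_ideal_adjoin//|x xK Sx]; apply: noS; by exists x.
  - exact: sub_ideal_adjoin.
  - exact: mem_ideal_adjoin.
have [||P PK] := prime_idealr_of Ki.
- by apply/negP => /KS.
- move=> a b abK; have [aK|/adjS[x xK Sx]] := boolP (a \in K); first by left.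
  have [bK|/adjS[y yK Sy]] := boolP (b \in K); first by right.
  by case: (KS (x * y) _ (SM _ _ Sx Sy)); apply: ideal_adjoin_mul xK yK.
by exists P; split=> x; rewrite PK; [apply: IK | apply: KS].
Qed.

(** Noetherian induction: a maximal counterexample [K] is proper and not prime, so it contains some
    [a * b] with neither factor in it. Every prime over [K] then contains [K + (a)] or [K + (b)],
    and the two finite lists can be concatenated. *)
Lemma finitely_many_minimal_primes I : ideal_closed I ->
  exists ps : seq (prime_idealr R), forall Q : prime_idealr R,
    {subset I <= Q} -> List.Exists (fun P : prime_idealr R => {subset P <= Q}) ps.
Proof.
move=> Ii; apply: contrapT => bad.
have [K [Ki Kbad Kmax]] := noetherian_max (P := fun I => ~ exists ps : seq _,
  forall Q : prime_idealr R, {subset I <= Q} ->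
    List.Exists (fun P : prime_idealr R => {subset P <= Q}) ps) Ii bad.
have adj a : a \notin K -> exists ps : seq _, forall Q : prime_idealr R,
    {subset ideal_adjoin K a <= Q} ->
    List.Exists (fun P : prime_idealr R => {subset P <= Q}) ps.
  move=> aK; apply: contrapT => abad; case/negP: aK.
  apply: Kmax abad _ _ _; first exact: ideal_adjoin_closed.
    exact: sub_ideal_adjoin.
  exact: mem_ideal_adjoin.
have adjQ a (Q : prime_idealr R) : {subset K <= Q} -> a \in Q ->
    {subset ideal_adjoin K a <= Q}.
  move=> KQ aQ x /asboolP[u [b [/KQ uQ ->]]].
  by rewrite rpredD // idealMr.
apply: Kbad; have [K1|K1] := boolP (1 \in K).
  by exists [::] => Q /(_ 1 K1); rewrite idealr1.
have [[a [b [abK aK bK]]]|Kp] := pselect (exists a b,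
    [/\ a * b \in K, a \notin K & b \notin K]).
  have [[ps psP] [qs qsP]] := (adj a aK, adj b bK).
  exists (ps ++ qs) => Q KQ; apply/List.Exists_app.
  have := KQ _ abK; rewrite prime_idealrM => /orP[aQ|bQ].
    by left; apply/psP/adjQ.
  by right; apply/qsP/adjQ.
have [|P PK] := prime_idealr_of Ki K1.
  move=> a b abK; have [aK|aK] := boolP (a \in K); first by left.
  have [bK|bK] := boolP (b \in K); first by right.
  by case: Kp; exists a, b.
by exists [:: P] => Q KQ; left => x; rewrite PK => /KQ.
Qed.

End NoetherianRings.

(** * Local rings and avoidance over an infinite residue field *)

Section LocalRings.
Variables (A : comNzRingType) (m : idealr A).
Hypotheses (A_noetherian : noetherian A) (A_local : local_with m).

(** If [a] had no inverse, the multiples of [a] would lie in a maximal ideal, which by locality is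
    [m]. *)
Lemma local_unit a : a \notin m -> exists b, b * a = 1.
Proof.
move=> am; apply: contrapT => nu.
pose aA : {pred A} := [pred x | `[< exists b, x = b * a >]].
have aAi : ideal_closed aA.
  split=> [|c _ _ /asboolP[b ->] /asboolP[d ->]]; apply/asboolP.
    by exists 0; rewrite mul0r.
  by exists (c * b + d); ring.
have aA1 : 1 \notin aA by apply/negP => /asboolP[b e]; apply: nu; exists b.
have [K [Ki [aK K1] Kmax]] := noetherian_max A_noetherian
  (P := fun K => {subset aA <= K} /\ 1 \notin K) aAi (conj (fun x h => h) aA1).
have [n nK] := idealr_of Ki K1.
have nm : n =i m.
  apply: A_local.2 => J nJ x xJ; rewrite nK.
  apply: (Kmax J (idealr_ideal_closed J)) xJ.
  - split; last by rewrite idealr1.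
    by move=> y /aK yK; apply: nJ; rewrite nK.
  - by move=> y yK; apply: nJ; rewrite nK.
by case/negP: am; rewrite -nm nK; apply: aK; apply/asboolP; exists 1; rewrite mul1r.
Qed.

Lemma local_prime a b : a * b \in m -> a \in m \/ b \in m.
Proof.
move=> abm; have [am|/local_unit[c ca]] := boolP (a \in m); first by left.
by right; rewrite -[b]mul1r -ca -mulrA idealMr.
Qed.

Lemma quot_eqP a b : (\pi_{ideal_quot m} a == \pi_{ideal_quot m} b) = (a - b \in m).
Proof. by rewrite Quotient.idealrBE. Qed.

Hypothesis k_infinite : infinite_set [set: {ideal_quot m}].

(** If [x + c0 * z] and [x + c * z] lie in [W] and [c], [c0] have different residues, then [z] and
    hence [x] lie in [W]. So a [W] that misses [x] rules out at most one residue class of [c]. *)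
Lemma subspace_line (x z : A) (I : {pred A}) (Ws : seq {pred A}) :
  z \in I ->
  List.Forall (fun W => ideal_closed W) Ws ->
  List.Forall (fun W => {subset I <= W} \/ x \notin W) Ws ->
  exists bad : seq {ideal_quot m}, forall c, \pi_{ideal_quot m} c \notin bad ->
    List.Forall (fun W : {pred A} => {subset I <= W} \/ x + c * z \notin W) Ws.
Proof.
move=> zI; elim: Ws => [|W Ws IH] Wi Wx; first by exists [::].
have [W_i Wsi] := (List.Forall_inv Wi, List.Forall_inv_tail Wi).
have [W_x Wsx] := (List.Forall_inv Wx, List.Forall_inv_tail Wx).
have [bad badP] := IH Wsi Wsx.
have [[c0 c0W]|no] := pselect (exists c, x + c * z \in W); last first.
  exists bad => c /badP; constructor=> //.
  by right; apply/negP => h; apply: no; exists c.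
exists (\pi c0 :: bad) => c; rewrite inE negb_or => /andP[cc0 /badP]; constructor=> //.
case: W_x => [|xW]; [by left | right]; apply: contra xW => cW.
rewrite quot_eqP in cc0; have [d dE] := local_unit cc0.
have zW : z \in W.
  have -> : z = d * ((x + c * z) - (x + c0 * z)).
    by transitivity (d * (c - c0) * z); [rewrite dE mul1r | ring].
  by apply: ideal_closedMr => //; apply: ideal_closedB.
have -> : x = (- c) * z + (x + c * z) by ring.
exact: W_i.2.
Qed.

(** This is the fact that a vector space over an infinite field is not a finite union of proper
    subspaces. When the current [x] falls into a new [W], it is moved along a line in the direction
    of some [z] of [I] outside [W]. *)
Lemma subspace_avoidance (I : {pred A}) (Ws : seq {pred A}) : ideal_closed I ->
  List.Forall (fun W => ideal_closed W) Ws ->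
  exists2 x, x \in I &
    List.Forall (fun W : {pred A} => {subset I <= W} \/ x \notin W) Ws.
Proof.
move=> Ii; elim: Ws => [|W Ws IH] Wi; first by exists 0; [exact: Ii.1 | constructor].
have [W_i Wsi] := (List.Forall_inv Wi, List.Forall_inv_tail Wi).
have [x xI xWs] := IH Wsi.
have [IW|/existsNP[z /not_implyP[zI /negP zW]]] := pselect {subset I <= W}.
  by exists x => //; constructor=> //; left.
have [xW|xW] := boolP (x \in W); last by exists x => //; constructor=> //; right.
have [bad badP] := subspace_line zI Wsi xWs.
(* The residue 0 is excluded too, so that [c] is a unit and [x + c * z] leaves [W]. *)
have [c cbad] : exists c, \pi_{ideal_quot m} c \notin \pi_{ideal_quot m} 0 :: bad.
  apply: contrapT => no; apply: k_infinite; apply/finite_seqP.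
  exists (\pi 0 :: bad); apply/seteqP; split=> // q _ /=.
  by apply/negPn/negP => h; apply: no; exists (repr q); rewrite reprK.
move: cbad; rewrite inE negb_or quot_eqP subr0 => /andP[/local_unit[d dc] /badP cWs].
exists (x + c * z); first by apply: ideal_closedD => //; apply: ideal_closedMr.
constructor=> //; right; apply: contra zW => xczW.
have -> : z = d * ((x + c * z) - x).
  by transitivity (d * c * z); [rewrite dc mul1r | ring].
by apply: ideal_closedMr => //; apply: ideal_closedB.
Qed.

End LocalRings.

(** * Hilbert's basis theorem *)

Section HilbertBasis.
Variable B : comNzRingType.
Hypothesis B_noetherian : noetherian B.
Variable J : {pred {poly B}}.
Hypothesis J_ideal : ideal_closed J.

(** Bounding the size instead of fixing it admits 0 as a leading coefficient, which makes this set
    an ideal. *)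
Definition lead_ideal (n : nat) : {pred B} :=
  [pred a | `[< exists f, [/\ f \in J, (size f <= n.+1)%N & f`_n = a] >]].

Lemma lead_ideal_closed n : ideal_closed (lead_ideal n).
Proof.
split=> [|a _ _ /asboolP[f [fJ fn <-]] /asboolP[g [gJ gn <-]]]; apply/asboolP.
  by exists 0; rewrite J_ideal.1 size_poly0 coef0.
exists (a%:P * f + g); split; first exact: J_ideal.2.
  rewrite (leq_trans (size_polyD _ _)) // geq_max gn andbT.
  by rewrite mul_polyC (leq_trans (size_scale_leq _ _)).
by rewrite coefD coefCM.
Qed.

Lemma lead_idealS n : {subset lead_ideal n <= lead_ideal n.+1}.
Proof.
move=> a /asboolP[f [fJ fn <-]]; apply/asboolP; exists ('X * f); split.
- exact: ideal_closedMr.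
- have [->|f0] := eqVneq f 0; first by rewrite mulr0 size_poly0.
  by rewrite mulrC size_mulX.
- by rewrite coefXM.
Qed.

Lemma lead_ideal_lift n : exists s : seq {poly B}, {subset s <= J} /\
  forall a, a \in lead_ideal n ->
    exists g, [/\ g \in ideal_gen s, (size g <= n.+1)%N & g`_n = a].
Proof.
have [t tP] := B_noetherian (lead_ideal_closed n).
have /choice[h hP] (a : B) : exists f : {poly B}, a \in lead_ideal n ->
    [/\ f \in J, (size f <= n.+1)%N & f`_n = a].
  have [/asboolP[f fP]|] := boolP (a \in lead_ideal n); first by exists f.
  by exists 0.
have tL i : (i < size t)%N -> t`_i \in lead_ideal n.
  by move=> it; rewrite tP mem_ideal_gen // mem_nth.
exists (map h t); split=> [_ /mapP[a /[swap] -> at_]|a].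
  by have [] := hP a; rewrite // tP mem_ideal_gen.
rewrite tP => /asboolP[c ->].
exists (\sum_(i < size t) (c i)%:P * h t`_i); split.
- apply/asboolP; exists (fun i => (c i)%:P); rewrite size_map.
  by apply: eq_bigr => i _; rewrite (nth_map 0).
- apply: (leq_trans (size_sum _ _ _)); apply/bigmax_leqP => i _.
  have [_ hn _] := hP _ (tL i (ltn_ord i)).
  by rewrite mul_polyC (leq_trans (size_scale_leq _ _)).
- rewrite coef_sum; apply: eq_bigr => i _; rewrite coefCM.
  by have [_ _ ->] := hP _ (tL i (ltn_ord i)).
Qed.

Lemma lead_ideal_lift_le n : exists s : seq {poly B}, {subset s <= J} /\
  forall i, (i <= n)%N -> forall a, a \in lead_ideal i ->
    exists g, [/\ g \in ideal_gen s, (size g <= i.+1)%N & g`_i = a].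
Proof.
elim: n => [|n [s [sJ sP]]].
  have [s [sJ sP]] := lead_ideal_lift 0; exists s; split=> // i.
  by rewrite leqn0 => /eqP->; exact: sP.
have [t [tJ tP]] := lead_ideal_lift n.+1; exists (s ++ t); split.
  by move=> x; rewrite mem_cat => /orP[/sJ|/tJ].
move=> i; rewrite leq_eqVlt => /predU1P[->|]; last rewrite ltnS.
  move=> a /tP[g [gt gn ga]]; exists g; split=> //; exact: ideal_gen_catr.
move=> le_in a /(sP i le_in)[g [gt gn ga]]; exists g; split=> //.
exact: ideal_gen_catl.
Qed.

(** Lifts of generators of the leading ideals up to the stationary index generate [J]: subtracting a
    combination with the same top coefficient lowers the size. *)
Lemma poly_ideal_fg : exists s : seq {poly B}, J =i ideal_gen s.
Proof.
have [n nP] := noetherian_chain B_noetherian lead_ideal_closed lead_idealS.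
have [s [sJ sP]] := lead_ideal_lift_le n.
have si := ideal_gen_closed s.
exists s => f; apply/idP/idP; last exact: ideal_gen_sub.
move: {2}(size f) (leqnn (size f)) => k; elim: k f => [|k IHk] f fk fJ.
  by move: fk; rewrite leqn0 size_poly_eq0 => /eqP->; exact: si.1.
have fL : f`_k \in lead_ideal k by apply/asboolP; exists f.
have [g [gs gk gf]] : exists g,
    [/\ g \in ideal_gen s, (size g <= k.+1)%N & g`_k = f`_k].
  have [le_kn|lt_nk] := leqP k n; first exact: sP.
  (* Beyond degree [n] the leading ideals no longer grow, so a lift in degree [n] shifted by a power
     of [X] suffices. *)
  have [g [gs gn gf]] := sP n (leqnn n) _ (nP _ _ fL).
  exists ('X^(k - n) * g); split; first exact: ideal_closedMr.
    have [->|g0] := eqVneq g 0; first by rewrite mulr0 size_poly0.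
    rewrite mulrC size_mulXn // -(subnK (ltnW lt_nk)) addnK -addnS.
    by rewrite leq_add2l.
  by rewrite coefXnM ltnNge leq_subr /= subKn // ltnW.
have gJ : g \in J by apply: (ideal_gen_sub J_ideal sJ).
rewrite -(subrK g f); apply: ideal_closedD => //; apply: IHk.
  apply/leq_sizeP => j; rewrite leq_eqVlt coefB => /predU1P[<-|kj].
    by rewrite gf subrr.
  by rewrite !nth_default ?subrr // (leq_trans _ kj).
exact: ideal_closedB.
Qed.

End HilbertBasis.

Lemma noetherian_poly (B : comNzRingType) : noetherian B -> noetherian {poly B}.
Proof. by move=> Bn J; apply: poly_ideal_fg. Qed.

Lemma noetherian_surj (B R : comNzRingType) (f : {rmorphism B -> R}) :
  noetherian B -> (forall r, exists b, r = f b) -> noetherian R.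
Proof.
move=> Bn fs J Ji; pose K : {pred B} := [pred b | f b \in J].
have Ki : ideal_closed K.
  split=> [|a u v]; rewrite !inE; first by rewrite rmorph0 Ji.1.
  by move=> uK vK; rewrite rmorphD rmorphM; apply: Ji.2.
have [s Ks] := Bn K Ki; exists (map f s) => r.
have [b ->] := fs r; apply/idP/idP => [bJ|].
  have : b \in K by [].
  rewrite Ks => /asboolP[a ->]; apply/asboolP; exists (fun i => f (a i)).
  rewrite size_map rmorph_sum; apply: eq_bigr => i _.
  by rewrite rmorphM (nth_map 0).
apply: ideal_gen_sub => // _ /mapP[c cs ->].
have : c \in K by rewrite Ks mem_ideal_gen.
by [].
Qed.

(* [S] ranges over the subrings containing the image of [B] and [s]. *)
Lemma noetherian_fg_algebra (R : comNzRingType) (s : seq R) (B : comNzRingType)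
    (f : {rmorphism B -> R}) : noetherian B ->
  (forall S : R -> Prop, (forall b, S (f b)) -> (forall x, x \in s -> S x) ->
     (forall x y, S x -> S y -> S (x + y)) ->
     (forall x y, S x -> S y -> S (x * y)) -> forall r, S r) ->
  noetherian R.
Proof.
elim: s => [|x s IHs] in B f * => Bn gen.
  apply: (noetherian_surj (f := f) Bn).
  apply: (gen (fun r => exists b, r = f b)) => //.
  - by move=> b; exists b.
  - by move=> _ _ [b ->] [c ->]; exists (b + c); rewrite rmorphD.
  - by move=> _ _ [b ->] [c ->]; exists (b * c); rewrite rmorphM.
have fx : commr_rmorph f x by move=> b; apply: mulrC.
(* The generator [x] is absorbed into the base ring by evaluating [B[X]] at it; Hilbert's theorem
   keeps the base noetherian. *)
apply: (IHs {poly B} (horner_morph fx) (noetherian_poly Bn)).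
move=> S fS sS SD SM; apply: gen => // [b|y].
  by have := fS b%:P; rewrite /= horner_morphC.
rewrite inE => /predU1P[->|]; last exact: sS.
by have := fS 'X; rewrite /= horner_morphX.
Qed.

(** * Regular elements and localization *)

Section PrimesAndRegularity.
Variable R : comNzRingType.
Hypothesis R_noetherian : noetherian R.

(** A prime that avoids all products [s * z ^+ n] with [s] outside [Q] lies inside [Q] and misses
    [z]. Regularity of [z] modulo [J] keeps [J] itself away from these products. *)
Lemma prime_below (J : {pred R}) (Q : prime_idealr R) z : ideal_closed J ->
  {subset J <= Q} -> (forall y, y * z \in J -> y \in J) ->
  exists P : prime_idealr R, [/\ {subset J <= P}, {subset P <= Q} & z \notin P].
Proof.
move=> Ji JQ zJ.
have [|||P [JP PS]] := prime_avoiding R_noetherian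
    (S := fun x => exists n s, s \notin Q /\ x = s * z ^+ n) Ji.
- by exists 0%N, 1; rewrite idealr1 expr0 mulr1.
- move=> _ _ [i [s [sQ ->]]] [j [t [tQ ->]]]; exists (i + j)%N, (s * t).
  by rewrite prime_idealrM negb_or sQ tQ exprD; split=> //; ring.
- move=> x xJ [n [s [sQ xE]]]; move: xJ; rewrite {}xE.
  elim: n => [|n IHn]; first by rewrite expr0 mulr1 => /JQ; apply/negP.
  by rewrite exprSr mulrA => /zJ/IHn.
exists P; split=> // [x xP|].
  apply/negPn/negP => xQ; apply: PS xP _.
  by exists 0%N, x; rewrite expr0 mulr1.
apply/negP => /PS; apply; exists 1%N, 1.
by rewrite idealr1 expr1 mul1r.
Qed.

Definition primes_triple (P0 P1 P2 : prime_idealr R) (n : nat) : prime_idealr R :=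
  match n with 0 => P0 | 1 => P1 | _ => P2 end.

Lemma prime_chain2 (P0 P1 P2 : prime_idealr R) : {subset P0 <= P1} -> ~ {subset P1 <= P0} ->
  {subset P1 <= P2} -> ~ {subset P2 <= P1} ->
  prime_chain 2 (primes_triple P0 P1 P2).
Proof. by move=> ? ? ? ? [|[|]]. Qed.

(** Two uses of [prime_below] give the strict inclusions: a prime below [Q] that contains the first
    element and misses the second, then a prime below that one that misses the first. *)
Lemma regular_seq_chain2 (Q : prime_idealr R) (x : seq R) : regular_seq x ->
  {subset x <= Q} -> (1 < size x)%N -> exists P, @prime_chain R 2 P.
Proof.
move=> [xreg _] xQ x2; have x1 : (0 < size x)%N by apply: ltnW.
have gQ i : {subset ideal_gen (take i x) <= Q}.
  by apply: (ideal_gen_sub (idealr_ideal_closed Q)) => y /mem_take/xQ.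
have [P1 [gP1 P1Q zP1]] := prime_below (ideal_gen_closed _) (gQ 1%N) (xreg 1%N x2).
have g01 : {subset ideal_gen (take 0 x) <= P1}.
  by apply: (ideal_gen_sub (idealr_ideal_closed P1)) => y; rewrite take0.
have [P0 [_ P0P1 zP0]] := prime_below (ideal_gen_closed _) g01 (xreg 0%N x1).
exists (primes_triple P0 P1 Q); apply: prime_chain2 => //.
  move=> P10; case/negP: zP0; apply/P10/gP1/mem_ideal_gen.
  by rewrite (take_nth 0 x1) take0 mem_head.
by move=> QP1; case/negP: zP1; apply/QP1/xQ/mem_nth.
Qed.

End PrimesAndRegularity.

Section Localization.
Variables (R : comNzRingType) (p : prime_idealr R).
Local Notation L := (loc p).
Local Notation fr := (@Defs.frac R p).
Local Notation d1 := (denom1 p).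

Lemma fracD a s b t : fr a s + fr b t = fr (a * dval t + b * dval s) (denomM s t).
Proof. exact: loc_addE. Qed.

Lemma fracM a s b t : fr a s * fr b t = fr (a * b) (denomM s t).
Proof. exact: loc_mulE. Qed.

Lemma frac01 : fr 0 d1 = 0. Proof. by []. Qed.
Lemma frac11 : fr 1 d1 = 1. Proof. by []. Qed.

Lemma frac_eq a s b t : a * dval t = b * dval s -> fr a s = fr b t.
Proof. by move=> e; apply/frac_eqP; exists d1; rewrite e. Qed.

Lemma frac_dvalK s a : fr (dval s) d1 * fr a s = fr a d1.
Proof. by rewrite fracM; apply: frac_eq => /=; ring. Qed.

Definition loc_max : {pred L} :=
  [pred x | `[< exists a s, a \in p /\ x = fr a s >]].

Lemma mem_loc_max a s : (fr a s \in loc_max) = (a \in p).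
Proof.
apply/asboolP/idP => [[b [t [bp /frac_eqP[u e]]]]|ap]; last by exists a, s.
have : dval u * (a * dval t) \in p by rewrite e idealMr // mulrC idealMr.
by rewrite !prime_idealrM !(negPf (denomP _)) /= orbF.
Qed.

Lemma loc_max_closed : ideal_closed loc_max.
Proof.
split; first by rewrite -frac01 mem_loc_max rpred0.
move=> x y z; have [[a [s ->]] [b [t ->]]] := (frac_surj x, frac_surj y).
have [c [r ->]] := frac_surj z; rewrite fracM fracD !mem_loc_max => bp cp.
by apply: rpredD; [rewrite mulrAC idealMr | rewrite mulrC idealMr].
Qed.

Lemma loc_max_prime : exists q : prime_idealr L, q =i loc_max.
Proof.
apply: prime_idealr_of; first exact: loc_max_closed.
  by rewrite -frac11 mem_loc_max idealr1.
move=> x y; have [[a [s ->]] [b [t ->]]] := (frac_surj x, frac_surj y).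
by rewrite fracM !mem_loc_max prime_idealrM => /orP.
Qed.

Lemma loc_max_unit x : x \notin loc_max -> exists y, y * x = 1.
Proof.
have [a [s ->]] := frac_surj x; rewrite mem_loc_max => ap.
exists (fr (dval s) (Denom ap)); rewrite fracM -frac11.
by apply: frac_eq => /=; ring.
Qed.

Lemma loc_ideal_sub (J : idealr L) : {subset J <= loc_max}.
Proof.
move=> x xJ; apply/negPn/negP => /loc_max_unit[y yx].
by have := idealr1 J; rewrite -yx idealMr.
Qed.

Lemma loc_local (q : prime_idealr L) : q =i loc_max -> local_with q.
Proof.
move=> qE; split=> [J _ x /loc_ideal_sub|n nmax x]; rewrite qE //.
apply/idP/idP => [/loc_ideal_sub//|]; rewrite -qE.
by apply: (nmax q) => y /loc_ideal_sub; rewrite qE.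
Qed.

(** An ideal of the localization is generated by the image of its contraction, since denominators
    are units. *)
Lemma loc_noetherian : noetherian R -> noetherian L.
Proof.
move=> Rn J Ji; pose K : {pred R} := [pred a | fr a d1 \in J].
have Ki : ideal_closed K.
  split=> [|a u v]; rewrite !inE; first by rewrite frac01 Ji.1.
  move=> uJ vJ; have -> : fr (a * u + v) d1 = fr a d1 * fr u d1 + fr v d1.
    by rewrite fracM fracD; apply: frac_eq => /=; ring.
  exact: Ji.2.
have [s Ks] := Rn K Ki; exists [seq fr a d1 | a <- s] => x.
apply/idP/idP => [|].
  have [a [t ->]] := frac_surj x => aJ.
  have : a \in K by rewrite !inE -(frac_dvalK t) ideal_closedMr.
  set G := ideal_gen _; have fg : ideal_closed G by apply: ideal_gen_closed.
  have fK : {subset ideal_gen s <= [pred a | fr a d1 \in G]}.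
    apply: ideal_gen_sub; last by move=> b bs; apply: mem_ideal_gen; apply: map_f.
    split=> [|b u v uJ vJ]; first exact: fg.1.
    change (fr (b * u + v) d1 \in G); have -> : fr (b * u + v) d1 = fr b d1 * fr u d1 + fr v d1.
      by rewrite fracM fracD; apply: frac_eq => /=; ring.
    exact: fg.2.
  rewrite Ks => /fK aG.
  have -> : fr a t = fr 1 t * fr a d1 by rewrite fracM; apply: frac_eq => /=; ring.
  exact: ideal_closedMr.
apply: ideal_gen_sub => // _ /mapP[a as_ ->].
have : a \in K by rewrite Ks mem_ideal_gen.
by [].
Qed.

Lemma loc_contract (q : prime_idealr L) :
  exists P : prime_idealr R, forall a, (a \in P) = (fr a d1 \in q).
Proof.
have [|||P PE] := @prime_idealr_of _ [pred a | fr a d1 \in q]; last by exists P.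
- split=> [|b u v]; rewrite !inE; first by rewrite frac01 rpred0.
  move=> uJ vJ; have -> : fr (b * u + v) d1 = fr b d1 * fr u d1 + fr v d1.
    by rewrite fracM fracD; apply: frac_eq => /=; ring.
  by rewrite rpredD // idealMr.
- by rewrite inE frac11 idealr1.
- move=> u v; rewrite !inE.
  have -> : fr (u * v) d1 = fr u d1 * fr v d1.
    by rewrite fracM; apply: frac_eq => /=; ring.
  by rewrite prime_idealrM => /orP.
Qed.

Lemma loc_chain n (q : nat -> prime_idealr L) : prime_chain n q ->
  exists P : nat -> prime_idealr R, prime_chain n P.
Proof.
move=> qc; have [P PE] := choice (fun i => loc_contract (q i)).
exists P => i /qc[qq nqq]; split=> [a|PP]; first by rewrite !PE; apply: qq.
apply: nqq => x; have [a [s ->]] := frac_surj x => aq.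
have : a \in P i.+1 by rewrite PE -(frac_dvalK s) idealMr.
move=> /PP; rewrite PE.
have -> : fr a s = fr 1 s * fr a d1 by rewrite fracM; apply: frac_eq => /=; ring.
exact: idealMr.
Qed.

(** The fraction [z / 1] is regular in the maximal ideal, so the depth is at least 1, and a prime
    missing it makes the dimension at least 1. A chain of three primes would contract to [R], and a
    regular sequence of length two would produce such a chain, so both numbers are 1. *)
Lemma cohen_macaulay_loc1 z : noetherian R ->
  (forall P : nat -> prime_idealr R, ~ prime_chain 2 P) ->
  z \in p -> (forall y, y * z = 0 -> y = 0) -> cohen_macaulay_local L.
Proof.
move=> Rn R2 zp zreg; have Ln := loc_noetherian Rn.
have [q qE] := loc_max_prime.
have L2 (P : nat -> prime_idealr L) : ~ prime_chain 2 P.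
  by move=> /loc_chain[Q /R2].
have zq : fr z d1 \in q by rewrite qE mem_loc_max.
have zLreg y : y * fr z d1 = 0 -> y = 0.
  have [a [s ->]] := frac_surj y; rewrite fracM -frac01 => /frac_eqP[u] /=.
  rewrite mulr1 mul0r mulr0 mulrA => /zreg ua0.
  by apply/frac_eqP; exists u; rewrite /= mulr1 ua0; ring.
have nil0 x : x \in ideal_gen [::] -> x = 0 :> L.
  by move=> /asboolP[a ->]; rewrite big_ord0.
exists q; split=> //; first exact: loc_local.
exists 1%N; split.
- have [||P [_ Pq zP]] := prime_below Ln (ideal_gen_closed [::]) (Q := q) (z := fr z d1).
  + by move=> x /nil0->; rewrite rpred0.
  + by move=> y /nil0/zLreg->; exact: (ideal_gen_closed _).1.
  exists (fun i => if i is 0 then P else q) => -[|//] _; split=> //.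
  by move=> /(_ _ zq); apply/negP.
- move=> n P Pc; rewrite leqNgt; apply/negP => n2; apply: (L2 P) => i i2.
  by apply: Pc; apply: leq_trans n2.
- have zsq : {subset [:: fr z d1] <= q} by move=> x; rewrite inE => /eqP->.
  exists [:: fr z d1]; split=> //.
    split=> [[|//] _ y /nil0/zLreg->|]; first exact: (ideal_gen_closed _).1.
    by apply/negP => /(ideal_gen_sub (idealr_ideal_closed q) zsq); rewrite idealr1.
- move=> x xreg xq; rewrite leqNgt; apply/negP => x2.
  by have [P /L2] := regular_seq_chain2 Ln xreg xq x2.
Qed.

End Localization.

(** * Fiber cones *)

Section FiberCone.
Variables (A : comNzRingType) (m : idealr A) (F : filtration A).
Local Notation fc := (fiber_cone m F).
Local Notation mF n := (ideal_mul m (F n)).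

(** [insubd] sends polynomials outside the Rees algebra to 0, which makes the map total; its
    algebraic laws therefore ask for membership. *)
Definition fiber_class (f : {poly A}) : fc :=
  \pi_({ideal_quot (@mrees A m F)}) (insubd (0 : rees F) f).
Local Notation cl := fiber_class.

Lemma mF_closed n : ideal_closed (mF n).
Proof. exact: ideal_mul_closed (idealr_ideal_closed m). Qed.

Lemma mF_mulr n k a b : a \in mF n -> b \in F k -> a * b \in mF (n + k)%N.
Proof.
move=> /asboolP[s [sP ->]] bF; rewrite mulr_suml.
apply: (ideal_closed_sum (mF_closed _)) => c /sP[cm cF]; rewrite -mulrA.
by apply: ideal_mulP => //; apply/fil_M/ideal_mulP.
Qed.

Lemma mF_mull n k a b : a \in F n -> b \in mF k -> a * b \in mF (n + k)%N.
Proof. by move=> aF bF; rewrite mulrC addnC; apply: mF_mulr. Qed.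

Lemma sub_mF_m n : {subset mF n <= m}.
Proof.
apply: (ideal_mul_sub (idealr_ideal_closed m)) => x y xm _.
by rewrite mulrC idealMr.
Qed.

Lemma mem_mF0 a : (a \in mF 0%N) = (a \in m).
Proof.
apply/idP/idP => [/sub_mF_m//|am]; rewrite -[a]mulr1.
by apply: ideal_mulP => //; apply: fil_0.
Qed.

Lemma insubd_rees f : f \in rees_pred F -> rees_val (insubd (0 : rees F) f) = f.
Proof. by move=> fR; apply: (insubdK 0). Qed.

Lemma fiber_classB f g : f \in rees_pred F -> g \in rees_pred F ->
  cl (f - g) = cl f - cl g.
Proof.
move=> fR gR; rewrite /fiber_class -rmorphB; congr (\pi _).
by apply: val_inj; rewrite /= !insubd_rees // rpredB.
Qed.

Lemma fiber_classD f g : f \in rees_pred F -> g \in rees_pred F ->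
  cl (f + g) = cl f + cl g.
Proof.
move=> fR gR; rewrite /fiber_class -rmorphD; congr (\pi _).
by apply: val_inj; rewrite /= !insubd_rees // rpredD.
Qed.

Lemma fiber_classM f g : f \in rees_pred F -> g \in rees_pred F ->
  cl (f * g) = cl f * cl g.
Proof.
move=> fR gR; rewrite /fiber_class -rmorphM; congr (\pi _).
by apply: val_inj; rewrite /= !insubd_rees // rpredM.
Qed.

Lemma fiber_class1 : cl 1 = 1.
Proof.
rewrite -(rmorph1 (\pi_({ideal_quot (@mrees A m F)}))) /fiber_class; congr (\pi _).
by apply: val_inj; rewrite /= !insubd_rees // rpred1.
Qed.

Lemma fiber_class_eq0 f : f \in rees_pred F ->
  cl f = 0 <-> forall n, f`_n \in mF n.
Proof.
move=> fR; rewrite /fiber_class -(rmorph0 (\pi_({ideal_quot (@mrees A m F)}))).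
split=> [/eqP|fm].
  by rewrite -Quotient.idealrBE subr0 => /asboolP; rewrite insubd_rees.
by apply/eqP; rewrite -Quotient.idealrBE subr0; apply/asboolP; rewrite insubd_rees.
Qed.

Lemma fiber_class_surj (r : fc) : exists2 f, f \in rees_pred F & r = cl f.
Proof.
exists (rees_val (repr r)); first by case: (repr r).
rewrite /fiber_class -[LHS]reprK; congr (\pi _); apply: val_inj => /=.
by rewrite insubd_rees //; case: (repr r).
Qed.

Definition fiber_hom (n : nat) (a : A) : fc := cl (a *: 'X^n).
Local Notation hom := fiber_hom.

Lemma rees_monomial n a : a \in F n -> a *: 'X^n \in rees_pred F.
Proof.
move=> aF; apply/reesP => k; rewrite coefZ coefXn.
have [->|_] := eqVneq; first by rewrite mulr1.
by rewrite mulr0; case: (fil_ideal F k).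
Qed.

Lemma fiber_homM n k a b : a \in F n -> b \in F k ->
  hom n a * hom k b = hom (n + k) (a * b).
Proof.
move=> aF bF; rewrite -fiber_classM ?rees_monomial //.
by rewrite -scalerAl -scalerAr scalerA -exprD.
Qed.

Lemma fiber_homD n a b : a \in F n -> b \in F n -> hom n (a + b) = hom n a + hom n b.
Proof. by move=> aF bF; rewrite -fiber_classD ?rees_monomial // -scalerDl. Qed.

Lemma fiber_homB n a b : a \in F n -> b \in F n -> hom n (a - b) = hom n a - hom n b.
Proof. by move=> aF bF; rewrite -fiber_classB ?rees_monomial // -scalerBl. Qed.

Lemma fiber_hom_eq0 n a : a \in F n -> hom n a = 0 <-> a \in mF n.
Proof.
move=> aF; rewrite fiber_class_eq0 ?rees_monomial //; split=> [/(_ n)|am k].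
  by rewrite coefZ coefXn eqxx mulr1.
rewrite coefZ coefXn; have [->|_] := eqVneq; first by rewrite mulr1.
by rewrite mulr0; apply: (mF_closed k).1.
Qed.

Lemma fiber_hom_eq n a b : a \in F n -> b \in F n ->
  a - b \in mF n -> hom n a = hom n b.
Proof.
move=> aF bF abm; apply/eqP; rewrite -subr_eq0 -fiber_homB //; apply/eqP.
by apply/fiber_hom_eq0 => //; apply: ideal_closedB => //; apply: fil_ideal.
Qed.

Lemma fiber_hom01 : hom 0 1 = 1.
Proof. by rewrite /fiber_hom scale1r expr0 fiber_class1. Qed.

Lemma fiber_ind (S : fc -> Prop) : (forall n a, a \in F n -> S (hom n a)) ->
  (forall x y, S x -> S y -> S (x + y)) -> forall r, S r.
Proof.
move=> Sh SD r; have [f fR ->] := fiber_class_surj r.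
have fF := reesP _ _ fR.
suff H k : S (cl (\sum_(i < k) f`_i *: 'X^i)) /\
    \sum_(i < k) f`_i *: 'X^i \in rees_pred F.
  by have [] := H (size f); rewrite -poly_def coefK.
elim: k => [|k [IHk kR]].
  rewrite big_ord0 rpred0; split=> //.
  by have := Sh 0%N 0 (fil_0 F 0); rewrite /fiber_hom scale0r.
rewrite big_ord_recr /= fiber_classD ?rees_monomial // rpredD ?rees_monomial //.
by split=> //; apply: SD => //; apply: Sh.
Qed.

Definition fiber_const (a : A) : fc := hom 0 a.

Fact fiber_const_additive : zmod_morphism fiber_const.
Proof. by move=> a b; rewrite /fiber_const fiber_homB ?fil_0. Qed.

Fact fiber_const_multiplicative : monoid_morphism fiber_const.
Proof.
split; first exact: fiber_hom01.
by move=> a b; rewrite /fiber_const fiber_homM ?fil_0.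
Qed.

HB.instance Definition _ :=
  GRing.isZmodMorphism.Build A fc fiber_const fiber_const_additive.
HB.instance Definition _ :=
  GRing.isMonoidMorphism.Build A fc fiber_const fiber_const_multiplicative.

Lemma fiber_constM n a b : b \in F n -> fiber_const a * hom n b = hom n (a * b).
Proof. by move=> bF; rewrite /fiber_const fiber_homM ?fil_0. Qed.

(** The degree-0 part of the cone is [A / m], so a constant coefficient in [m] means a vanishing
    degree-0 component. *)
Definition fiber_irrelevant : {pred fc} :=
  [pred r | `[< exists f, [/\ f \in rees_pred F, f`_0 \in m & r = cl f] >]].

Lemma mem_fiber_irrelevant f : f \in rees_pred F ->
  (cl f \in fiber_irrelevant) = (f`_0 \in m).
Proof.
move=> fR; apply/asboolP/idP => [[g [gR gm fg]]|fm]; last by exists f.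
have /(fiber_class_eq0 (rpredB fR gR))/(_ 0%N) : cl (f - g) = 0.
  by rewrite fiber_classB // fg subrr.
by move=> /sub_mF_m; rewrite coefB => fgm; rewrite -[f`_0](subrK g`_0) rpredD.
Qed.

Lemma fiber_irrelevant_closed : ideal_closed fiber_irrelevant.
Proof.
split.
  apply/asboolP; exists 0; rewrite rpred0 coef0 rpred0; split=> //; apply/esym.
  by apply/fiber_class_eq0; rewrite ?rpred0 // => n; rewrite coef0 (mF_closed n).1.
move=> x y z; have [f fR ->] := fiber_class_surj x.
have [g gR ->] := fiber_class_surj y; have [h hR ->] := fiber_class_surj z.
rewrite -fiber_classM // -fiber_classD ?rpredM // !mem_fiber_irrelevant //.
  by rewrite coefD coef0M => gm hm; rewrite rpredD // idealMr.
by rewrite rpredD // rpredM.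
Qed.

Lemma fiber_hom_irrelevant n a : a \in F n.+1 -> hom n.+1 a \in fiber_irrelevant.
Proof.
move=> aF; rewrite mem_fiber_irrelevant ?rees_monomial //.
by rewrite coefZ coefXn mulr0 rpred0.
Qed.

Hypotheses (A_noetherian : noetherian A) (A_local : local_with m).

Lemma fiber_irrelevant_prime : exists M : prime_idealr fc, M =i fiber_irrelevant.
Proof.
apply: prime_idealr_of; first exact: fiber_irrelevant_closed.
  by rewrite -fiber_class1 mem_fiber_irrelevant ?rpred1 // coef1 idealr1.
move=> x y; have [f fR ->] := fiber_class_surj x.
have [g gR ->] := fiber_class_surj y; rewrite -fiber_classM //.
rewrite !mem_fiber_irrelevant // ?rpredM // coef0M.
exact: (local_prime A_noetherian A_local).
Qed.

Lemma mF_unit n a b : a \notin m -> a * b \in mF n -> b \in mF n.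
Proof.
move=> /(local_unit A_noetherian A_local)[c ca] abF.
by rewrite -[b]mul1r -ca -mulrA; apply: ideal_closedMr => //; apply: mF_closed.
Qed.

(* The lowest-degree coefficient of the product is that of the other factor
   multiplied by a unit. *)
Lemma fiber_regular x y : x \notin fiber_irrelevant -> y * x = 0 -> y = 0.
Proof.
have [f fR ->] := fiber_class_surj x; have [g gR ->] := fiber_class_surj y.
rewrite mem_fiber_irrelevant // -fiber_classM // => f0.
have gfR : g * f \in rees_pred F by rewrite rpredM.
move=> /(fiber_class_eq0 gfR) gf; apply/fiber_class_eq0 => // n.
have [fF gF] := (reesP _ _ fR, reesP _ _ gR).
elim/ltn_ind: n => n IHn; apply: (mF_unit f0).
have := gf n; rewrite mulrC coefM big_ord_recl subn0 => h.
rewrite -[_ * _](addrK (\sum_(i < n) f`_(lift ord0 i) * g`_(n - lift ord0 i))).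
apply: ideal_closedB (mF_closed n) h _.
apply: (ideal_closed_sum (mF_closed n)) => i _.
rewrite -[X in mF X](subnKC (leq_ord (lift ord0 i))); apply: mF_mull => //.
by apply: IHn; rewrite ltn_subrL /= (leq_trans _ (ltn_ord i)).
Qed.

(** The cone is generated over [A] by generators of the ideals [F n] in low degrees: in higher
    degrees every element is, modulo [m], a sum of products of an element of degree 1 and one of the
    preceding degree. *)
Lemma fiber_noetherian n0 :
  (forall n, (n0 <= n)%N -> forall a, a \in F n.+1 ->
     exists2 b, b \in ideal_mul (F 1%N) (F n) & a - b \in mF n.+1) ->
  noetherian fc.
Proof.
move=> gen.
have [s sP] := choice (fun n => A_noetherian (fil_ideal F n)).
(* Degrees 0 to [n0 + 1] are taken, so that degree 1 is present even when [n0] is 0. *)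
pose g := flatten [seq [seq hom i c | c <- s i] | i <- iota 0 n0.+2].
apply: (noetherian_fg_algebra (s := g) (f := fiber_const) A_noetherian).
move=> S Sc Sg SD SM; apply: fiber_ind => //.
have S0 n : S (hom n 0).
  have -> : hom n 0 = fiber_const 0 by rewrite /fiber_const /fiber_hom !scale0r.
  exact: Sc.
have Ssum n (I : eqType) (r : seq I) (h : I -> A) :
    (forall i, i \in r -> h i \in F n /\ S (hom n (h i))) ->
    S (hom n (\sum_(i <- r) h i)).
  move=> hS; suff [] : \sum_(i <- r) h i \in F n /\ S (hom n (\sum_(i <- r) h i)) by [].
  rewrite big_seq; elim/big_ind: _ => //; first by split=> //; apply: (fil_ideal F n).1.
  move=> x y [xF xS] [yF yS]; split; first exact: ideal_closedD (fil_ideal F n) _ _ _ _.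
  by rewrite fiber_homD //; apply: SD.
have Slow n a : (n < n0.+2)%N -> a \in F n -> S (hom n a).
  move=> nn; rewrite sP => /asboolP[c ->]; apply: Ssum => i _.
  have si : (s n)`_i \in F n by rewrite sP mem_ideal_gen // mem_nth.
  split; first exact: ideal_closedMr (fil_ideal F n) _ _ _.
  rewrite -fiber_constM //; apply: SM => //; apply: Sg.
  apply/flattenP; exists [seq hom n c | c <- s n].
    by apply/mapP; exists n => //; rewrite mem_iota.
  by apply/mapP; exists (s n)`_i => //; apply: mem_nth.
elim=> [|n IHn] a aF; first exact: Slow.
have [nn|nn] := ltnP n n0.+1; first exact: Slow.
have [b bF abm] := gen n (ltnW nn) a aF.
have bF' : b \in F n.+1 by apply: (fil_M (n := 1)).
rewrite (fiber_hom_eq aF bF' abm).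
move: bF => /asboolP[t [tF ->]]; apply: Ssum => c /tF[c1 c2].
split; first by apply: (fil_M (n := 1)); apply: ideal_mulP.
rewrite -(fiber_homM (n := 1)) //; apply: SM; last exact: IHn.
exact: Slow.
Qed.

End FiberCone.

(** * Fiber cones with a regular reduction of degree 1 *)

(** Take a monic [p = q X + a] of least degree with [p(z)] in [P]. Its constant term maps into [Q]
    because [z] is in [Q]; if it mapped into [P], then [q(z) * z] and hence [q(z)] would be in [P],
    against minimality. *)
Lemma integral_incomparable (B R : comNzRingType) (f : {rmorphism B -> R})
    (P Q : prime_idealr R) (z : R) : integralOver f z ->
  {subset P <= Q} -> z \in Q -> z \notin P -> exists2 b, f b \in Q & f b \notin P.
Proof.
move=> [p0 p0_monic /eqP p0z] PQ zQ zP.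
pose good n := `[< exists p : {poly B},
  [/\ p \is monic, size p = n & (map_poly f p).[z] \in P] >].
have ex_good : exists n, good n.
  by exists (size p0); apply/asboolP; exists p0; rewrite p0z rpred0.
have [n /asboolP[p [p_monic <- pz]] min_p] := ex_minnP ex_good.
move: p_monic pz min_p; elim/poly_ind: p => [|q a _].
  by rewrite monicE lead_coef0 eq_sym oner_eq0.
have [->|q0] := eqVneq q 0.
  rewrite mul0r add0r => /monicP; rewrite lead_coefC => ->.
  by rewrite map_polyC hornerC /= rmorph1 idealr1.
have sz_lt : (size (a%:P : {poly B}) < size (q * 'X)%R)%N.
  by rewrite size_polyC size_mulX // ltnS (leq_trans (leq_b1 _)) // size_poly_gt0.
rewrite monicE lead_coefDl // lead_coefMX -monicE size_polyDl // size_mulX //.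
rewrite rmorphD rmorphM /= map_polyX map_polyC hornerD hornerMX hornerC => qm pz min_p.
have azQ : f a \in Q.
  rewrite -[f a](addKr ((map_poly f q).[z] * z)) rpredD ?rpredN ?idealMr //.
  exact: PQ.
exists a => //; apply/negP => faP.
have : (map_poly f q).[z] * z \in P.
  by rewrite -[_ * z](addrK (f a)) rpredB.
rewrite prime_idealrM (negPf zP) orbF => qz.
have /min_p : good (size q) by apply/asboolP; exists q.
by rewrite ltnn.
Qed.

(** * Primes of polynomials over the residue field, handled in [A[X]] *)

Section PolynomialsOverLocalRing.
Variables (A : comNzRingType) (m : idealr A).
Hypotheses (A_noetherian : noetherian A) (A_local : local_with m).
Local Notation mX f := (forall i, f`_i \in m).

Lemma sub_mX (P : idealr {poly A}) (f : {poly A}) :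
  (forall a, a \in m -> a%:P \in P) -> mX f -> f \in P.
Proof.
move=> mP fm; rewrite -[f]coefK poly_def; apply: rpred_sum => i _.
by rewrite -mul_polyC mulrC idealMr // mP.
Qed.

(* The ideals of k[X] are principal, read in A[X] modulo m[X]. *)
Lemma monic_generator (P : idealr {poly A}) (f : {poly A}) :
  (forall a, a \in m -> a%:P \in P) -> f \in P -> ~ mX f ->
  exists g : {poly A}, [/\ g \is monic, g \in P,
    forall h, h \in P -> ~ mX h -> (size g <= size h)%N &
    forall h, h \in P -> mX (Pdiv.Ring.rmodp h g)].
Proof.
move=> mP fP fm.
pose good n := `[< exists h : {poly A}, [/\ h \in P, ~ mX h & size h = n] >].
have ex_good : exists n, good n by exists (size f); apply/asboolP; exists f.
have [n /asboolP[h [hP hm <-]] min_h] := ex_minnP ex_good.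
have min_h' h' : h' \in P -> ~ mX h' -> (size h <= size h')%N.
  by move=> ? ?; apply: min_h; apply/asboolP; exists h'.
have h0 : h != 0.
  by apply/eqP => h0; apply: hm => i; rewrite h0 coef0 rpred0.
(* Otherwise dropping the leading term leaves a shorter element of [P] outside [m[X]]. *)
have lcm : lead_coef h \notin m.
  apply/negP => lcm; pose h' := h - (lead_coef h)%:P * 'X^((size h).-1).
  have h'P : h' \in P by rewrite rpredB // mulrC idealMr // mP.
  suff : (size h <= size h')%N.
    apply/negP; rewrite -ltnNge [X in (_ < X)%N]polySpred // ltnS.
    apply/leq_sizeP => j; rewrite coefB coefCM coefXn leq_eqVlt => /predU1P[<-|lt_j].
      by rewrite eqxx mulr1 subrr.
    rewrite (gtn_eqF lt_j) mulr0 subr0 nth_default // polySpred //.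
  apply: min_h' => // h'm; apply: hm => i.
  rewrite -[h](subrK ((lead_coef h)%:P * 'X^((size h).-1))) coefD rpredD //.
  by rewrite coefCM mulrC idealMr.
have [d dl] := local_unit A_noetherian A_local lcm.
pose g := d%:P * h.
have gsz : (size g <= size h)%N by rewrite /g mul_polyC size_scale_leq.
have glc : g`_((size h).-1) = 1 by rewrite coefCM.
have gP : g \in P by rewrite idealMr.
have gszE : size g = size h.
  apply/eqP; rewrite eqn_leq gsz [X in (X <= _)%N]polySpred // ltnNge.
  apply/negP => /leq_sizeP/(_ _ (leqnn _)); rewrite glc => /eqP.
  by rewrite oner_eq0.
have gmon : g \is monic by rewrite monicE lead_coefE gszE glc.
exists g; split=> // h' h'P; first by rewrite gszE; apply: min_h'.
have rP : Pdiv.Ring.rmodp h' g \in P.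
  rewrite -[X in X \in _](addKr (Pdiv.Ring.rdivp h' g * g)).
  by rewrite -Pdiv.RingMonic.rdivp_eq // addrC rpredB // idealMr.
(* A remainder outside [m[X]] would be shorter than the minimal [h]. *)
apply: contrapT => /(min_h' _ rP); apply/negP.
by rewrite -ltnNge -gszE Pdiv.Ring.ltn_rmodpN0 // monic_neq0.
Qed.

(** Modulo [m[X]], the generator [g] of [P] is a multiple [q g'] of the generator of [Q]. As [P] is
    prime, either [g'] is in [P] and [Q] lies in [P], or [q] is in [P]; then [g] is no longer than
    [q], so [g'] is the constant 1 and [Q] is not proper. *)
Lemma poly_primes_dim1 (P Q : prime_idealr {poly A}) (f : {poly A}) :
  (forall a, a \in m -> a%:P \in P) -> f \in P -> ~ mX f ->
  {subset P <= Q} -> {subset Q <= P}.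
Proof.
move=> mP fP fm PQ; have mQ a am := PQ _ (mP a am).
have [g [g_monic gP g_min gdiv]] := monic_generator mP fP fm.
have [g' [g'_monic g'Q g'_min g'div]] := monic_generator mQ (PQ f fP) fm.
have mXP := sub_mX mP.
pose q := Pdiv.Ring.rdivp g g'; pose r := Pdiv.Ring.rmodp g g'.
have gE : g = q * g' + r by apply: Pdiv.RingMonic.rdivp_eq.
have rm : mX r := g'div _ (PQ _ gP).
have : q * g' \in P by rewrite -[q * g'](addrK r) -gE rpredB // mXP.
rewrite prime_idealrM => /orP[qP|g'P]; last first.
  move=> h hQ; rewrite (Pdiv.RingMonic.rdivp_eq g'_monic h) rpredD ?idealMr //.
  exact/mXP/g'div.
have gm : ~ mX g.
  by move=> /(_ (size g).-1); rewrite -lead_coefE (monicP g_monic) idealr1.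
have qm : ~ mX q.
  move=> qm; apply: gm => i; rewrite gE coefD rpredD // coefM.
  by apply: rpred_sum => j _; rewrite mulrC idealMr.
have q0 : q != 0 by apply/eqP => q0; apply: qm => i; rewrite q0 coef0 rpred0.
have g'0 := monic_neq0 g'_monic.
have r_lt : (size r < size g')%N by rewrite Pdiv.Ring.ltn_rmodpN0.
have qg'_sz : size (q * g') = (size q + size g').-1 by rewrite size_Mmonic.
have g_sz : size g = (size q + size g').-1.
  rewrite gE size_polyDl qg'_sz // (leq_trans r_lt) //.
  by rewrite -(prednK (n := size q)) ?size_poly_gt0 //= leq_addl.
have : (size q + size g' <= (size q).+1)%N.
  have := g_min q qP qm; rewrite g_sz.
  by rewrite -(prednK (n := size g')) ?size_poly_gt0 // addnS.
rewrite -addn1 leq_add2l => /size1_polyC g'C.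
have := g'Q; rewrite g'C; move: g'_monic; rewrite {1}g'C monicE lead_coefC.
by move=> /eqP->; rewrite idealr1.
Qed.

End PolynomialsOverLocalRing.

Section PrincipalReduction.
Variables (A : comNzRingType) (m : idealr A) (F : filtration A) (w : A).
Hypotheses (A_noetherian : noetherian A) (A_local : local_with m).
Local Notation fc := (fiber_cone m F).
Local Notation mF n := (ideal_mul m (F n)).
Local Notation hom := (@fiber_hom A m F).
Hypothesis w_F1 : w \in F 1%N.
Hypothesis w_onto : forall n, (0 < n)%N -> forall a, a \in F n.+1 ->
  exists2 b, b \in F n & a - w * b \in mF n.+1.
Hypothesis w_regular : forall n a, a \in F n -> w * a \in mF n.+1 -> a \in mF n.

Let y : fc := hom 1 w.

Lemma reduction_surj n a : (0 < n)%N -> a \in F n.+1 ->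
  exists2 b, b \in F n & hom n.+1 a = y * hom n b.
Proof.
move=> n_gt0 aF; have [b bF abm] := w_onto n_gt0 aF; exists b => //.
rewrite fiber_homM //; apply: fiber_hom_eq => //.
by apply: (fil_M (n := 1)); apply: ideal_mulP.
Qed.

(** Multiplication by [y] only shifts degrees by one, so [w_regular] applies to each coefficient. *)
Lemma reduction_regular (r : fc) : r * y = 0 -> r = 0.
Proof.
have [f fR ->] := fiber_class_surj r => rf0.
apply/fiber_class_eq0 => // n; apply: w_regular; first exact: (reesP _ _ fR).
have wR := rees_monomial w_F1.
rewrite /y /fiber_hom -fiber_classM // in rf0.
have fwR : f * (w *: 'X^1) \in rees_pred F by rewrite rpredM.
have := (fiber_class_eq0 m fwR).1 rf0 n.+1.
by rewrite -scalerAr coefZ coefMXn subn1.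
Qed.

Fact fiber_const_comm : commr_rmorph (@fiber_const A m F) y.
Proof. by move=> a; apply: mulrC. Qed.

Let phi : {rmorphism {poly A} -> fc} := horner_morph fiber_const_comm.

Let phiC a : phi a%:P = fiber_const m F a.
Proof. exact: horner_morphC. Qed.

Let phiX : phi 'X = y.
Proof. exact: horner_morphX. Qed.

(* With z of degree 1, write z^(n+1) = y^n d_n with d_n in F_1; the ideals
   (d_0, ..., d_n) of A are stationary, and a relation expressing d_(N+1)
   through d_0, ..., d_N is an integral equation for z. *)
Lemma integral_degree1 c : c \in F 1%N -> integralOver phi (hom 1 c).
Proof.
move=> cF; set z := hom 1 c.
have /choice[d dP] n : exists d, d \in F 1%N /\ z ^+ n.+1 = y ^+ n * hom 1 d.
  elim: n => [|n [d [dF zE]]]; first by exists c; rewrite expr0 mul1r expr1.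
  have dcF : d * c \in F 2%N by apply: (fil_M (n := 1)); apply: ideal_mulP.
  have [e eF dcE] := reduction_surj (n := 1) isT dcF.
  exists e; split=> //; rewrite exprSr zE -mulrA fiber_homM // dcE.
  by rewrite mulrA -exprSr.
have Ii n := ideal_gen_closed (mkseq d n.+1).
have [|N /(_ N.+1) NP] := noetherian_chain A_noetherian Ii.
  move=> n; apply: ideal_gen_sub => // x xn; apply: mem_ideal_gen.
  by rewrite /mkseq -addn1 iotaD map_cat mem_cat xn.
have /NP/asboolP[a] : d N.+1 \in ideal_gen (mkseq d N.+2).
  by apply/mem_ideal_gen/mapP; exists N.+1; rewrite // mem_iota /= add0n.
rewrite size_mkseq => dE.
(* With [X] standing for [y], the coefficient of [z^(i+1)] is [a_i y^(N+1-i)], because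
   [y^(N+1) d_i = y^(N+1-i) z^(i+1)]. *)
pose s : {poly {poly A}} := \sum_(i < N.+1) (a i *: 'X^(N.+1 - i)) *: 'X^(i.+1).
have s_sz : (size s <= N.+2)%N.
  apply: (leq_trans (size_sum _ _ _)); apply/bigmax_leqP => i _.
  rewrite (leq_trans (size_scale_leq _ _)) // size_polyXn !ltnS.
  by rewrite -ltnS.
exists ('X^(N.+2) - s).
  by rewrite monicE lead_coefDl ?lead_coefXn // size_polyN size_polyXn ltnS.
rewrite /root rmorphB /= map_polyXn hornerD hornerN hornerXn subr_eq0; apply/eqP.
have [dN zN] := dP N.+1; rewrite zN dE.
have homsum (r : seq 'I_N.+1) (h : 'I_N.+1 -> A) : (forall i, h i \in F 1%N) ->
    hom 1 (\sum_(i <- r) h i) = \sum_(i <- r) hom 1 (h i).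
  move=> hF; elim: r => [|i r IHr].
    rewrite !big_nil; apply/fiber_hom_eq0; first exact: (fil_ideal F 1).1.
    exact: (mF_closed m F 1).1.
  rewrite !big_cons fiber_homD ?IHr //.
  by apply: ideal_closed_sum => // *; apply: fil_ideal.
have dF i : a i * (mkseq d N.+1)`_i \in F 1%N.
  have [iN|Ni] := ltnP i N.+1.
    rewrite nth_mkseq //; have [diF _] := dP i.
    exact: ideal_closedMr (fil_ideal F 1) _ _ diF.
  by rewrite nth_default ?size_mkseq // mulr0; apply: (fil_ideal F 1).1.
rewrite homsum // mulr_sumr rmorph_sum horner_sum; apply: eq_bigr => i _ /=.
rewrite map_polyZ map_polyXn hornerZ hornerXn nth_mkseq //.
have [diF ->] := dP i; rewrite -fiber_constM // -mul_polyC rmorphM rmorphXn /=.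
rewrite phiC phiX mulrCA -mulrA; congr (_ * _).
by rewrite mulrA -exprD subnK // ltnW.
Qed.

(** Constants come from [A], degree 1 is already integral, and each higher degree is [y] times the
    preceding one. *)
Lemma integral_fiber_cone (r : fc) : integralOver phi r.
Proof.
apply: fiber_ind r => [|x x']; last exact: integral_add.
case=> [a _|n]; first by rewrite -/(fiber_const m F a) -phiC; apply: integral_id.
elim: n => [|n IHn] a aF; first exact: integral_degree1.
have [b bF ->] := reduction_surj (n := n.+1) isT aF.
by apply: integral_mul; [rewrite -phiX; apply: integral_id | apply: IHn].
Qed.

(** By incomparability a chain of three primes contracts to three distinct primes of [A[X]], all
    containing [m]. The middle one is not zero modulo [m[X]], so nothing lies strictly above it. *)
Lemma fiber_cone_dim_le1 (P : nat -> prime_idealr fc) : ~ prime_chain 2 P.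
Proof.
move=> Pc; have [P01 nP10] := Pc 0%N isT; have [P12 nP21] := Pc 1%N isT.
have step i : {subset P i <= P i.+1} -> ~ {subset P i.+1 <= P i} ->
    exists2 b, phi b \in P i.+1 & phi b \notin P i.
  move=> sub /existsNP[z /not_implyP[zQ /negP zP]].
  exact: integral_incomparable (integral_fiber_cone z) sub zQ zP.
have [f fP1 fP0] := step 0%N P01 nP10; have [g gP2 gP1] := step 1%N P12 nP21.
have contract i : exists Q : prime_idealr {poly A},
    forall b, (b \in Q) = (phi b \in P i).
  have [|||Q QE] := @prime_idealr_of _ [pred b | phi b \in P i]; last by exists Q.
  - split=> [|a u v uP vP]; first by rewrite inE rmorph0 rpred0.
    by rewrite inE rmorphD rmorphM rpredD // idealMr.
  - by rewrite inE rmorph1 idealr1.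
  - by move=> u v; rewrite !inE rmorphM prime_idealrM => /orP.
have phim a : a \in m -> phi a%:P = 0.
  move=> am; rewrite phiC; apply/fiber_hom_eq0; first exact: fil_0.
  by rewrite mem_mF0.
have [[Q0 Q0E] [[Q1 Q1E] [Q2 Q2E]]] := (contract 0%N, (contract 1%N, contract 2%N)).
case/negP: gP1; rewrite -Q1E.
apply: (poly_primes_dim1 A_noetherian A_local (f := f) (Q := Q2)).
- by move=> a am; rewrite Q1E phim // rpred0.
- by rewrite Q1E.
- move=> fm; case/negP: fP0; rewrite -Q0E; apply: (sub_mX _ fm) => a am.
  by rewrite Q0E phim // rpred0.
- by move=> b; rewrite Q1E Q2E; apply: P12.
- by rewrite Q2E.
Qed.

Lemma reduction_noetherian : noetherian fc.
Proof.
apply: (fiber_noetherian A_noetherian (n0 := 1)) => n n_gt0 a aF.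
have [b bF abm] := w_onto n_gt0 aF; exists (w * b) => //.
exact: ideal_mulP.
Qed.

Lemma reduction_cohen_macaulay : cohen_macaulay fc.
Proof.
split=> [|p p_max]; first exact: reduction_noetherian.
suff [z zp zreg] : exists2 z, z \in p & forall r, r * z = 0 -> r = 0.
  exact: cohen_macaulay_loc1 reduction_noetherian fiber_cone_dim_le1 zp zreg.
have [p_irr|/existsNP[z /not_implyP[zp /negP zirr]]] :=
    pselect {subset p <= @fiber_irrelevant A m F}; last first.
  by exists z => // r; apply: fiber_regular.
exists y; last exact: reduction_regular.
have [M ME] := fiber_irrelevant_prime F A_noetherian A_local.
(* A maximal ideal inside the irrelevant ideal equals it, hence contains [y], which has positive
   degree. *)
apply: (p_max M) => [r /p_irr|]; rewrite ME //.
exact: fiber_hom_irrelevant.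
Qed.

End PrincipalReduction.

(** * Analytic spread one *)

Section AnalyticSpreadOne.
Variables (A : comNzRingType) (m : idealr A) (F : filtration A) (I : {pred A}).
Hypotheses (A_noetherian : noetherian A) (A_local : local_with m).
Hypothesis I_good : good_for I F.
Local Notation fc := (fiber_cone m F).
Local Notation mF n := (ideal_mul m (F n)).
Local Notation hom := (@fiber_hom A m F).

Lemma good_sub_fil1 : {subset I <= F 1%N}.
Proof.
have [_ IF _] := I_good; move=> x xI; rewrite -[x]mulr1.
by apply: (IF 0%N); apply: ideal_mulP => //; apply: fil_0.
Qed.

Lemma good_noetherian : noetherian fc.
Proof.
have [_ _ [n0 n0P]] := I_good.
apply: (fiber_noetherian A_noetherian (n0 := n0)) => n /n0P FE a.
rewrite FE => aIF; exists a; last by rewrite subrr; case: (mF_closed m F n.+1).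
have FFi := ideal_mul_closed (F n) (fil_ideal F 1).
by apply: (ideal_mul_sub FFi) aIF => u v /good_sub_fil1; apply: ideal_mulP.
Qed.

(** From degree [n0] on each step of the filtration is multiplication by [I], and [I] lies in [F 1],
    so [k] steps are absorbed into [F k]. *)
Lemma good_split n0 : (forall n, (n0 <= n)%N -> F n.+1 =i ideal_mul I (F n)) ->
  forall k n, (n0 <= n)%N -> {subset F (k + n)%N <= ideal_mul (F k) (F n)}.
Proof.
move=> n0P k n le_n0n; elim: k => [|k IHk] a.
  by move=> aF; rewrite -[a]mul1r; apply: ideal_mulP => //; apply: fil_0.
rewrite addSn n0P; last by rewrite (leq_trans le_n0n) ?leq_addl.
have FFi j := ideal_mul_closed (F n) (fil_ideal F j).
apply: (ideal_mul_sub (FFi _)) => u v uI /IHk/asboolP[s [sF ->]].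
rewrite mulr_sumr; apply: (ideal_closed_sum (FFi _)) => c /sF[c1 c2].
rewrite mulrA; apply: ideal_mulP => //.
by apply: (fil_M (n := 1)); apply: ideal_mulP => //; apply: good_sub_fil1.
Qed.

Lemma fiber_hom_split (K : {pred fc}) (z : fc) (U : {pred A}) k n :
  ideal_closed K -> {subset U <= F k} ->
  (forall u v, u \in U -> v \in F n -> z * (hom k u * hom n v) \in K) ->
  forall a, a \in ideal_mul U (F n) -> z * hom (k + n) a \in K.
Proof.
move=> Ki UF zK a /asboolP[s [sF ->]].
have FF c : c \in s -> c.1 * c.2 \in F (k + n)%N.
  by move=> /sF[/UF c1 c2]; apply: fil_M; apply: ideal_mulP.
suff [] : \sum_(c <- s) c.1 * c.2 \in F (k + n)%N /\
  z * hom (k + n) (\sum_(c <- s) c.1 * c.2) \in K by [].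
rewrite big_seq; elim/big_ind: _ => [|a1 a2 [F1 K1] [F2 K2]|c cs].
- have F0 := (fil_ideal F (k + n)).1; split=> //.
  rewrite (fiber_hom_eq0 m F0).2 ?mulr0; first exact: Ki.1.
  exact: (mF_closed m F _).1.
- split; first exact: ideal_closedD (fil_ideal F _) _ _ _ _.
  by rewrite fiber_homD // mulrDr; apply: ideal_closedD.
- by have [c1 c2] := sF c cs; split; [exact: FF | rewrite -fiber_homM ?UF //; apply: zK].
Qed.

Lemma fiber_hom_exp n k a : a \in F n -> hom n a ^+ k = hom (n * k) (a ^+ k) /\
  a ^+ k \in F (n * k)%N.
Proof.
move=> aF; elim: k => [|k [IHk akF]].
  by rewrite muln0 !expr0 fiber_hom01 fil_0.
rewrite !exprS mulnS IHk fiber_homM //; split=> //.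
by apply: fil_M; apply: ideal_mulP.
Qed.

Hypothesis k_infinite : infinite_set [set: {ideal_quot m}].
Hypothesis spread1 : analytic_spread_eq m F 1.

(* [x] is chosen outside the minimal primes of the fiber cone not containing
   all of [I] in degree 1.  An ideal over [y = x t] maximal among those that do
   not contain a multiple of all high degrees by an element outside the
   irrelevant ideal is prime and would sit strictly between a minimal prime and
   the irrelevant ideal. *)
Lemma exists_reduction : exists2 x, x \in I & exists N, forall n, (N <= n)%N ->
  forall a, a \in F n.+1 -> exists2 b, b \in F n & a - x * b \in mF n.+1.
Proof.
have [Ii _ [n0 n0P]] := I_good; have fcN := good_noetherian.
have [M ME] := fiber_irrelevant_prime F A_noetherian A_local.
have [ps psP] := finitely_many_minimal_primes fcN (ideal_gen_closed [::]).
(* The trace on [I] of the degree-1 part of [P]; these finitely many ideals are the subspaces to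
   avoid. *)
pose W (P : prime_idealr fc) : {pred A} := [pred a | (a \in I) && (hom 1 a \in P)].
have Wi : List.Forall (fun W : {pred A} => ideal_closed W) (List.map W ps).
  apply/List.Forall_map/List.Forall_forall => P _; split.
    rewrite inE Ii.1 (fiber_hom_eq0 m (fil_ideal F 1).1).2 ?rpred0 //.
    exact: (mF_closed m F 1).1.
  move=> a u v /andP[uI uP] /andP[vI vP]; rewrite inE Ii.2 //=.
  have [uF vF] := (good_sub_fil1 uI, good_sub_fil1 vI).
  rewrite fiber_homD ?ideal_closedMr //; try exact: fil_ideal.
  by rewrite -fiber_constM // rpredD // idealMr.
have [x xI xW] := subspace_avoidance A_noetherian A_local k_infinite Ii Wi.
exists x => //; have xF := good_sub_fil1 xI; set y := hom 1 x.
pose cofinite (K : {pred fc}) := exists N z, z \notin @fiber_irrelevant A m F /\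
  forall n, (N <= n)%N -> forall a, a \in F n -> z * hom n a \in K.
have irr1 : 1 \notin @fiber_irrelevant A m F by rewrite -ME idealr1.
pose yfc : {pred fc} := ideal_gen [:: y].
have yfci : ideal_closed yfc by apply: ideal_gen_closed.
(* With [f] and [g] representing [z] and the cofactor of [y], degree [n+1] of the relation says that
   [f_0 a] is congruent to [x g_n] modulo [m F_(n+1)], and [f_0] is a unit because [z] is not
   irrelevant. *)
suff [N [z [zirr zN]]] : cofinite yfc.
  exists N => n le_Nn a aF; have /asboolP[s] := zN n.+1 (leqW le_Nn) a aF.
  rewrite big_ord1 /=; move: zirr; have [f fR ->] := fiber_class_surj z.
  have [g gR ->] := fiber_class_surj (s 0%N); rewrite mem_fiber_irrelevant // => f0.
  have [aR xR] := (rees_monomial aF, rees_monomial xF).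
  rewrite /y /fiber_hom -!fiber_classM // => /eqP.
  rewrite -subr_eq0 -fiber_classB ?rpredM // => /eqP/fiber_class_eq0.
  rewrite rpredB ?rpredM // => /(_ isT n.+1).
  rewrite coefB -!scalerAr !coefZ !coefMXn ltnn subnn subn1 /= => fg.
  have [d df] := local_unit A_noetherian A_local f0.
  exists (d * g`_n).
    by apply: ideal_closedMr; [exact: fil_ideal | exact: (reesP _ _ gR)].
  have -> : a - x * (d * g`_n) = d * (a * f`_0 - x * g`_n).
    by rewrite mulrBr [d * (a * _)]mulrCA df; ring.
  by apply: ideal_closedMr => //; apply: mF_closed.
apply: contrapT => ybad.
have [K [Ki [yK Kbad] Kmax]] := noetherian_max fcN
  (P := fun K => {subset yfc <= K} /\ ~ cofinite K) yfci (conj (fun _ h => h) ybad).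
have Kadj a : a \notin K -> cofinite (ideal_adjoin K a).
  move=> aK; apply: contrapT => aKbad; case/negP: aK.
  apply: (Kmax (ideal_adjoin K a)); first exact: ideal_adjoin_closed.
  - by split=> // r /yK/sub_ideal_adjoin.
  - exact: sub_ideal_adjoin.
  - exact: mem_ideal_adjoin.
have [||Q QK] := prime_idealr_of Ki.
- apply/negP => K1; apply: Kbad; exists 0%N, 1; split=> // n _ a aF.
  by rewrite mulrC; apply: ideal_closedMr.
- move=> a b abK; have [aK|/Kadj[N1 [z1 [z1irr z1K]]]] := boolP (a \in K); first by left.
  have [bK|/Kadj[N2 [z2 [z2irr z2K]]]] := boolP (b \in K); first by right.
  (* A degree beyond this bound splits as [N1] plus a rest that is at least [n0], where the
     filtration factors, and at least [N2]. *)
  case: Kbad; exists (N1 + maxn n0 N2)%N, (z1 * z2); split.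
    by rewrite -ME prime_idealrM !ME negb_or z1irr.
  move=> n le_n c; rewrite -(subnKC (leq_trans (leq_addr _ _) le_n)).
  have : (maxn n0 N2 <= n - N1)%N by rewrite leq_subRL // (leq_trans (leq_addr _ _) le_n).
  rewrite geq_max => /andP[n0n N2n] /(good_split n0P n0n).
  apply: fiber_hom_split => // u v uF vF.
  have -> : z1 * z2 * (hom N1 u * hom (n - N1) v) =
    (z1 * hom N1 u) * (z2 * hom (n - N1) v) by ring.
  by apply: ideal_adjoin_mul (z1K _ _ _ uF) (z2K _ _ _ vF).
have KM : {subset Q <= M}.
  (* Such an [r] could itself be the multiplier [z] in [cofinite K], which is why that notion allows
     a multiplier. *)
  move=> r; rewrite QK ME => rK; apply/negPn/negP => rirr; apply: Kbad.
  by exists 0%N, r; split=> // n _ a aF; rewrite mulrC; apply: ideal_closedMr.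
(* If [K] contained all of [I] in degree 1, it would contain every degree beyond [n0], since there
   [F n.+1] is [I] times [F n]. *)
have [u uI uK] : exists2 u, u \in I & hom 1 u \notin K.
  apply: contrapT => no; apply: Kbad; exists n0.+1, 1; split=> // -[//|n] n0n a.
  rewrite n0P // => aIF; rewrite -add1n.
  apply: (fiber_hom_split (U := I)) aIF => //; first exact: good_sub_fil1.
  move=> c d cI dF; rewrite mul1r mulrC; apply: ideal_closedMr => //.
  by apply/negPn/negP => cK; apply: no; exists c.
have uF := good_sub_fil1 uI.
have Q0 : {subset ideal_gen [::] <= Q}.
  by move=> r /asboolP[c ->]; rewrite big_ord0 rpred0.
have [P [Pps PQ]] := (List.Exists_exists _ _).1 (psP Q Q0).
have yQ : y \in Q by rewrite QK; apply/yK/mem_ideal_gen; rewrite mem_head.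
(* By the choice of [x], either [P] contains all of [I] in degree 1, which [u] forbids, or [P]
   misses [y]. *)
have [IW|xWP] := (List.Forall_forall _ _).1 xW (W P) (List.in_map _ _ _ Pps).
  by case/negP: uK; rewrite -QK; apply: PQ; have /andP[] := IW u uI.
have yP : y \notin P by apply: contra xWP => yP; apply/andP.
suff /spread1.2 : prime_chain 2 (primes_triple P Q M) by [].
apply: prime_chain2 => // [QP|MQ]; first by case/negP: yP; apply: QP.
case/negP: uK; rewrite -QK; apply: MQ; rewrite ME.
exact: fiber_hom_irrelevant.
Qed.

(* Otherwise the irrelevant ideal consists of nilpotents and is the only prime. *)
Lemma spread1_nonzero N : ~ forall n, (N <= n)%N -> forall a, a \in F n -> a \in mF n.
Proof.
move=> FmF; have [[p /(_ 0%N isT)[p01 /existsNP[z /not_implyP[zp1 zp0]]]] _] := spread1.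
(* Modulo [p 0] every element is a constant: the [N]-th power of an element of positive degree has
   degree at least [N], where the cone vanishes. *)
have [c cP] : exists c, z - fiber_const m F c \in p 0%N.
  move: {zp1 zp0} z; apply: fiber_ind => [[|n] a aF|r s [c rc] [d sd]].
  - by exists a; rewrite subrr rpred0.
  - exists 0; rewrite rmorph0 subr0.
    have : hom n.+1 a ^+ N \in p 0%N.
      have [-> aNF] := fiber_hom_exp N aF.
      by rewrite (fiber_hom_eq0 m aNF).2 ?rpred0 // FmF // leq_pmull.
    elim: N {FmF} => [|k IHk]; first by rewrite expr0 idealr1.
    by rewrite exprS prime_idealrM => /orP[|/IHk].
  - exists (c + d); rewrite rmorphD.
    have -> : r + s - (fiber_const m F c + fiber_const m F d) =
      (r - fiber_const m F c) + (s - fiber_const m F d) by ring.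
    by rewrite rpredD.
(* The constant is either zero in the cone, which puts [z] in [p 0], or a unit lying in [p 1]. *)
have [cm|/(local_unit A_noetherian A_local)[d dc]] := boolP (c \in m).
  apply: zp0; move: cP; rewrite /fiber_const.
  by rewrite (fiber_hom_eq0 m (fil_0 F c)).2 ?subr0 // mem_mF0.
have : fiber_const m F c \in p 1%N.
  by rewrite -[fiber_const m F c](subKr z) rpredB //; apply: p01.
move=> /(idealMr (fiber_const m F d)).
by rewrite -rmorphM dc rmorph1 idealr1.
Qed.

Variables (x : A) (N : nat).
Hypothesis x_F1 : x \in F 1%N.
Hypothesis x_onto : forall n, (N <= n)%N -> forall a, a \in F n.+1 ->
  exists2 b, b \in F n & a - x * b \in mF n.+1.

Lemma exp_fil k : x ^+ k \in F k.
Proof. by have [_] := fiber_hom_exp k x_F1; rewrite mul1n. Qed.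

(** Factors [x] are split off one at a time; all intermediate degrees stay at least [N], and the
    errors add up inside [m F]. *)
Lemma reduction_exp_onto k n a : (N <= n)%N -> a \in F (k + n)%N ->
  exists2 b, b \in F n & a - x ^+ k * b \in mF (k + n)%N.
Proof.
move=> le_Nn; elim: k a => [|k IHk] a aF.
  by exists a; rewrite // expr0 mul1r subrr; case: (mF_closed m F n).
have [b bF abm] := x_onto (leq_trans le_Nn (leq_addl k n)) aF.
have [c cF bcm] := IHk b bF; exists c => //.
have -> : a - x ^+ k.+1 * c = (a - x * b) + x * (b - x ^+ k * c).
  by rewrite exprS; ring.
apply: ideal_closedD => //; first exact: mF_closed.
by rewrite addSn -add1n; apply: mF_mull.
Qed.

(** Were [x ^+ k] in [m F_k], surjectivity of multiplication by it would give [F n = m F_n] for all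
    large [n]. *)
Lemma reduction_exp_nonzero k : x ^+ k \notin mF k.
Proof.
apply/negP => xkm; apply: (spread1_nonzero (N := k + N)) => n le_kNn a.
rewrite -(subnKC (leq_trans (leq_addr _ _) le_kNn)) => aF.
have le_Nn : (N <= n - k)%N by rewrite leq_subRL // (leq_trans (leq_addr _ _) le_kNn).
have [b bF abm] := reduction_exp_onto le_Nn aF.
rewrite -[a](subrK (x ^+ k * b)); apply: ideal_closedD => //.
  exact: mF_closed.
exact: mF_mulr.
Qed.

(* The annihilators of the powers of [x t] are stationary. *)
Lemma reduction_exp_regular : exists N', forall n, (N' <= n)%N -> forall k a,
  a \in F n -> x ^+ k * a \in mF (k + n)%N -> a \in mF n.
Proof.
set y := hom 1 x.
have yE k : y ^+ k = hom k (x ^+ k).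
  by have [-> _] := fiber_hom_exp k x_F1; rewrite mul1n.
pose Ann k : {pred fc} := [pred r | r * y ^+ k == 0].
have [k||i iP] := noetherian_chain good_noetherian (I := Ann).
- split=> [|r s t /eqP sA /eqP tA]; first by rewrite inE mul0r.
  by rewrite inE mulrDl -mulrA sA tA mulr0 addr0.
- by move=> k r /eqP rA; rewrite inE exprSr mulrA rA mul0r.
(* Annihilators stop growing at [i], and from degree [i + N] on the class of [a] is [y^i b]. If
   [y^k] kills it, then [y^(k+i)] kills [b], hence so does [y^i]. *)
exists (i + N)%N => n le_n k a.
have le_in := leq_trans (leq_addr _ _) le_n.
have le_Nn : (N <= n - i)%N by rewrite leq_subRL.
rewrite -(subnKC le_in) => aF xam.
have [b bF abm] := reduction_exp_onto le_Nn aF.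
have xibF : x ^+ i * b \in F (i + (n - i))%N.
  by apply: fil_M; apply: ideal_mulP => //; apply: exp_fil.
have homab : hom (i + (n - i)) a = hom (n - i) b * y ^+ i.
  by rewrite (fiber_hom_eq aF xibF abm) yE [RHS]mulrC fiber_homM // exp_fil.
apply/(fiber_hom_eq0 m aF); rewrite homab; apply/eqP.
apply: (iP (k + i)%N (hom (n - i) b)); apply/eqP.
rewrite addnC exprD mulrA -homab mulrC yE fiber_homM ?exp_fil //.
apply/fiber_hom_eq0 => //; apply: fil_M; apply: ideal_mulP => //; exact: exp_fil.
Qed.

End AnalyticSpreadOne.

Theorem corollary4p3 (A : comNzRingType) (m : idealr A) (F : filtration A)
    (A_noetherian : noetherian A) (A_local : local_with m)
    (k_infinite : infinite_set [set: {ideal_quot m}])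
    (F_good : good_filtration F) (spread1 : analytic_spread_eq m F 1) :
  exists T0 : nat, forall (T : nat) (T_gt0 : (0 < T)%N), (T0 <= T)%N ->
    cohen_macaulay (fiber_cone m (veronese F T_gt0)).
Proof.
have [I I_good] := F_good.
have [x xI [N xN]] := exists_reduction A_noetherian A_local I_good k_infinite spread1.
have xF := good_sub_fil1 I_good xI.
have xT := reduction_exp_nonzero A_noetherian A_local spread1 xF xN.
have [N' xN'] := reduction_exp_regular A_noetherian I_good xF xN.
(* [N] serves surjectivity and [N'] regularity; both bounds hold in the degrees [T * n] with [n]
   positive, which are at least [T]. *)
exists (maxn N N') => T T_gt0; rewrite geq_max => /andP[le_NT le_N'T].
have le_Tn n : (0 < n)%N -> (T <= T * n)%N by move=> n_gt0; rewrite leq_pmulr.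
apply: (reduction_cohen_macaulay (w := x ^+ T) A_noetherian A_local).
- by rewrite /= muln1; apply: exp_fil.
- move=> n /le_Tn le_n a; rewrite /= mulnS => aF.
  by have := reduction_exp_onto xF xN (leq_trans le_NT le_n) aF.
- move=> [|n] a aF; rewrite /= mulnS; last first.
    by apply: xN' => //; rewrite (leq_trans le_N'T) ?le_Tn.
  (* Degree 0 may lie below [N']. There an [a] outside [m] is a unit, and cancelling it would put
     [x ^+ T] in [m F_T]. *)
  rewrite muln0 addn0 mem_mF0 => xam; apply/negPn/negP => am.
  case/negP: (xT T); apply: (mF_unit A_noetherian A_local am).
  by rewrite mulrC.
Qed.
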